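(* For the algorithm $\mathrm{Alg}(p_1^{*},\alpha_1^{*},d_1^{*},p_2^{*},\alpha_2^{*},d_2^{*})$ described in the context, with $p_1^{*}=2.62666582851$, $\alpha_1^{*}=2\pi/9$, $d_1^{*}=0.490011696287$, $p_2^{*}=2.97374843355$, $\alpha_2^{*}=0.05523991\pi$, $d_2^{*}=0.1670474016$, the worst-case exit position (among the exit positions on the arc $A$ together with the artificial exits $\tilde E_3,\tilde E_5$, as defined in the context) is at $E_1$, $E_2$, $\tilde E_3$, $E_4$ or $\tilde E_5$.
   Context: Evacuation problem: two robots $R_1,R_2$ start at the center $O=(0,0)$ of the closed unit disk and move at unit speed. An exit is located at an unknown point of the boundary circle. A robot learns the exit location only when it reaches that point, and the robots can exchange information (instantaneously) only when at the same point. The evacuation time for a given exit position is the time until both robots have reached the exit; a worst-case exit position is one maximizing the evacuation time. Algorithm $\mathrm{Alg}(p_1,\alpha_1,d_1,p_2,\alpha_2,d_2)$: Let $I=(0,1)$, $I'=(0,-1)$. Until the exit is found: both robots move straight from $O$ to $I$. Then $R_1$ moves counterclockwise and $R_2$ clockwise along the circle. After each has covered arc length $p_1$, $R_1$ is at $C_1=(-\sin p_1,\cos p_1)$ and $R_2$ at $C_1'=(\sin p_1,\cos p_1)$; they perform a first cut: $R_1$ moves straight from $C_1$ in direction $(\cos\alpha_1,\sin\alpha_1)$ for distance $d_1$ (to $P_1$), $R_2$ moves straight from $C_1'$ in direction $(-\cos\alpha_1,\sin\alpha_1)$ for distance $d_1$ (to $P_1'$); each returns along the same segment and continues along the circle in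 its previous direction. After each has covered total arc length $p_2$ along the circle, $R_1$ is at $C_2=(-\sin p_2,\cos p_2)$, $R_2$ at $C_2'=(\sin p_2,\cos p_2)$; they perform a second cut in the same way with angle $\alpha_2$ and length $d_2$, return and continue along the circle. Meeting protocol: if a robot finds the exit at $E$ at time $t_0$, it computes the smallest $t\ge0$ such that the other robot, following its trajectory above, is at time $t_0+t$ at a point $M$ with $|EM|=t$ (the meeting point); it moves straight to $M$, and both then move straight to $E$; the evacuation time is $t_0+2t$. By symmetry one considers exits on the arc $A$ of the circle from $I$ counterclockwise to $I'$ (the half with $x\le 0$), found by $R_1$. With the starred parameters define the following points of $A$ (arc lengths measured from $I$ along $A$): $E_1$ is the exit position whose meeting point is $C_1'$, reached by $R_2$ before its first cut (arc length $\approx 0.629973871925$); $E_2$ is the exit position for which $R_2$ is picked up at $C_1'$ just after completing its first cut (arc length $\approx 2.590020657077$); $E_3=C_1$ (arc length $p_1^*$); $E_4$ is the exit position for which $R_2$ is picked up at $C_2'$ just after completing its second cut (arc length $\approx 2.972352082515$); $E_5=C_2$ (arc length $p_2^*$). The artificial exit $\tilde E_3$ is an exit located at the point $C_1$ but regarded as found by $R_1$ only when it returns to $C_1$ after completing its first cut; similarly $\tilde E_5$ is an exit at $C_2$ regarded as found by $R_1$ only upon returning to $C_2$ after completing its second cut (in both cases the meeting protocol is then applied). *)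

(* Defs.v *)
From Stdlib Require Export Reals.
Open Scope R_scope.

Definition point : Type := (R * R)%type.

Definition distance (A B : point) : R :=
  dist_euc (fst A) (snd A) (fst B) (snd B).

Definition is_least (S : R -> Prop) (x : R) : Prop :=
  S x /\ forall y, S y -> x <= y.

Record params : Type := Alg
  { p1 : R; alpha1 : R; d1 : R; p2 : R; alpha2 : R; d2 : R }.

(* [sg = -1] is the counterclockwise side (robot R_1), [sg = 1] the clockwise
   side (robot R_2); [s] is the arc length measured from I = (0,1). *)
Definition circ (sg s : R) : point := (sg * sin s, cos s).

(* Point at distance [l] from the cut's starting point [circ sg p]; the
   direction is (cos a, sin a) for R_1 and (- cos a, sin a) for R_2. *)
Definition cut (sg p a l : R) : point :=
  (fst (circ sg p) - sg * (l * cos a), snd (circ sg p) + l * sin a).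

Definition cut1_start (P : params) : R := 1 + p1 P.
Definition cut1_end (P : params) : R := cut1_start P + 2 * d1 P.
Definition cut2_start (P : params) : R := cut1_end P + (p2 P - p1 P).
Definition cut2_end (P : params) : R := cut2_start P + 2 * d2 P.

(* Position at time [t >= 0] of a robot that has not been told of the exit. *)
Definition trajectory (P : params) (sg t : R) : point :=
  if Rle_dec t 1 then (0, t)
  else if Rle_dec t (cut1_start P) then circ sg (t - 1)
  else if Rle_dec t (cut1_start P + d1 P) then
    cut sg (p1 P) (alpha1 P) (t - cut1_start P)
  else if Rle_dec t (cut1_end P) then
    cut sg (p1 P) (alpha1 P) (cut1_end P - t)
  else if Rle_dec t (cut2_start P) then circ sg (p1 P + (t - cut1_end P))
  else if Rle_dec t (cut2_start P + d2 P) then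
    cut sg (p2 P) (alpha2 P) (t - cut2_start P)
  else if Rle_dec t (cut2_end P) then
    cut sg (p2 P) (alpha2 P) (cut2_end P - t)
  else circ sg (p2 P + (t - cut2_end P)).

Definition robot1 (P : params) : R -> point := trajectory P (-1).
Definition robot2 (P : params) : R -> point := trajectory P 1.

(* [t] is the time that elapses between the discovery of the exit [E] by R_1
   at time [t0] and the meeting with R_2. *)
Definition meeting (P : params) (E : point) (t0 t : R) : Prop :=
  is_least (fun u => 0 <= u /\ distance E (robot2 P (t0 + u)) = u) t.

(* [Exit s] is the exit at arc length [s] on the half circle from I
   counterclockwise to I'; [Artificial3] and [Artificial5] lie at C_1 and C_2
   but count as found only when R_1 is back from its first, resp. second,
   cut. *)
Inductive exit : Type :=
  | Exit (s : R)
  | Artificial3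
  | Artificial5.

Definition on_arc (s : R) : Prop := 0 <= s <= PI.

Definition admissible (e : exit) : Prop :=
  match e with
  | Exit s => on_arc s
  | Artificial3 | Artificial5 => True
  end.

Definition location (P : params) (e : exit) : point :=
  match e with
  | Exit s => circ (-1) s
  | Artificial3 => circ (-1) (p1 P)
  | Artificial5 => circ (-1) (p2 P)
  end.

Definition found (P : params) (e : exit) (t0 : R) : Prop :=
  match e with
  | Exit s => is_least (fun t => 0 <= t /\ robot1 P t = location P e) t0
  | Artificial3 => t0 = cut1_end P
  | Artificial5 => t0 = cut2_end P
  end.

Definition evacuation_time (P : params) (e : exit) (T : R) : Prop :=
  exists t0 t, found P e t0 /\ meeting P (location P e) t0 t /\ T = t0 + 2 * t.

Definition worst_case (P : params) (e : exit) : Prop :=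
  admissible e /\
  exists T, evacuation_time P e T /\
    forall e', admissible e' ->
      exists T', evacuation_time P e' T' /\ T' <= T.

(* For the exit at arc length [s], R_2 is picked up at time [tau] and at the
   point [M]. *)
Definition picked_up (P : params) (s tau : R) (M : point) : Prop :=
  on_arc s /\
  exists t0 t, found P (Exit s) t0 /\ meeting P (location P (Exit s)) t0 t /\
    t0 + t = tau /\ robot2 P tau = M.

Definition is_E1 (P : params) (s : R) : Prop :=
  picked_up P s (cut1_start P) (circ 1 (p1 P)).
Definition is_E2 (P : params) (s : R) : Prop :=
  picked_up P s (cut1_end P) (circ 1 (p1 P)).
Definition is_E4 (P : params) (s : R) : Prop :=
  picked_up P s (cut2_end P) (circ 1 (p2 P)).

Definition Alg_star : params :=
  Alg 2.62666582851 (2 * PI / 9) 0.490011696287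
      2.97374843355 (0.05523991 * PI) 0.1670474016.

(* Main.v *)
From Stdlib Require Import Reals Lra Psatz Factorial.
Require Import Defs.
Open Scope R_scope.

(* Since R_2 moves at unit speed, |E - R_2(t0 + u)| - u is nonincreasing in u, so
   the exit E found at time t0 is evacuated by time T as soon as
   |E - R_2(t0 + u)| <= u for u = (T - t0) / 2.  With T the evacuation time of
   one of the five candidates, moving the exit by 2l along the arc therefore
   means following R_2 for l more time units while the allowed distance drops
   by l; the resulting inequality is an equality at l = 0 and is an elementary
   trigonometric estimate on each piece of R_2's trajectory.  The candidates
   E_1 (backward and forward), E_2 (backward and forward), the artificial E_3
   (forward), E_4 (backward and forward) and the artificial E_5 (forward) cover
   the arc, up to two tiny intervals of exits met near the turning points of
   the cuts, whose evacuation times are clearly smaller.  The five candidate times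
   differ by about 1e-8 only, so the maximum is left undetermined. *)

(** * Taylor bounds for sine and cosine *)

(** Horner forms of the Taylor polynomials of the sine, of degree 19 here and 17 below; cutting the
    alternating series after a negative term bounds from below, after a positive one from above. *)
Definition taylor_sin_lower (x : R) : R :=
  x * (1 - x^2/6*(1 - x^2/20*(1 - x^2/42*(1 - x^2/72*(1 - x^2/110*
    (1 - x^2/156*(1 - x^2/210*(1 - x^2/272*(1 - x^2/342))))))))).

Definition taylor_sin_upper (x : R) : R :=
  x * (1 - x^2/6*(1 - x^2/20*(1 - x^2/42*(1 - x^2/72*(1 - x^2/110*
    (1 - x^2/156*(1 - x^2/210*(1 - x^2/272)))))))).

(** Gives the ratio of consecutive Taylor terms, so that the sums expand without evaluating unary
    factorials. *)
Lemma inv_fact_step (n : nat) :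
  / INR (fact (S (S n))) = / INR (fact n) / ((INR n + 1) * (INR n + 2)).
Proof.
  rewrite !fact_simpl, !mult_INR, !S_INR.
  pose proof (INR_fact_neq_0 n). pose proof (pos_INR n).
  field; repeat split; lra || auto.
Qed.

Lemma sin_term_succ (x : R) (i : nat) :
  sin_term x (S i) =
  sin_term x i * (- x ^ 2 / ((2 * INR i + 2) * (2 * INR i + 3))).
Proof.
  unfold sin_term, Rdiv.
  replace (2 * S i + 1)%nat with (S (S (2 * i + 1))) by ring.
  rewrite inv_fact_step, plus_INR, mult_INR.
  pose proof (INR_fact_neq_0 (2 * i + 1)). pose proof (pos_INR i).
  simpl pow. simpl (INR 1). simpl (INR 2). field; repeat split; lra || auto.
Qed.

Lemma cos_term_succ (x : R) (i : nat) :
  cos_term x (S i) =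
  cos_term x i * (- x ^ 2 / ((2 * INR i + 1) * (2 * INR i + 2))).
Proof.
  unfold cos_term, Rdiv.
  replace (2 * S i)%nat with (S (S (2 * i))) by ring.
  rewrite inv_fact_step, mult_INR.
  pose proof (INR_fact_neq_0 (2 * i)). pose proof (pos_INR i).
  simpl pow. simpl (INR 2). field; repeat split; lra || auto.
Qed.

Lemma sin_term_0 (x : R) : sin_term x 0 = x.
Proof. unfold sin_term; simpl; field. Qed.

Lemma cos_term_0 (x : R) : cos_term x 0 = 1.
Proof. unfold cos_term; simpl; field. Qed.

Ltac expand_taylor H :=
  unfold sin_approx, cos_approx in H; cbn [sum_f_R0 Nat.mul Nat.add] in H;
  rewrite ?sin_term_succ, ?cos_term_succ, ?sin_term_0, ?cos_term_0 in H;
  cbn [INR] in H.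

Lemma taylor_sin_bounds (x : R) :
  0 <= x <= 4 -> taylor_sin_lower x <= sin x <= taylor_sin_upper x.
Proof.
  intros [H0 H4].
  destruct (pre_sin_bound x 4 H0 H4) as [Hl _].
  destruct (pre_sin_bound x 3 H0 H4) as [_ Hu].
  expand_taylor Hl. expand_taylor Hu. split.
  - eapply Rle_trans; [right | exact Hl]. unfold taylor_sin_lower. field.
  - eapply Rle_trans; [exact Hu | right]. unfold taylor_sin_upper. field.
Qed.

Lemma sin_le_arg (x : R) : 0 <= x -> sin x <= x.
Proof.
  intros [H | <-]; [left; apply sin_lt_x, H | rewrite sin_0; lra].
Qed.

Lemma sin_abs_le (x : R) : Rabs (sin x) <= Rabs x.
Proof.
  assert (A : forall y, 0 <= y -> Rabs (sin y) <= y).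
  { intros y Hy. destruct (Rle_lt_dec y 1).
    - rewrite Rabs_pos_eq; [apply sin_le_arg, Hy|].
      pose proof PI2_1. apply sin_ge_0; lra.
    - pose proof (SIN_bound y). apply Rabs_le; lra. }
  destruct (Rle_lt_dec 0 x).
  - rewrite (Rabs_pos_eq x) by lra. auto.
  - rewrite <- Rabs_Ropp, <- sin_neg, <- (Rabs_Ropp x), (Rabs_pos_eq (- x)) by lra.
    apply A; lra.
Qed.

Lemma sin_ge_cubic (x : R) : 0 <= x <= 4 -> x - x ^ 3 / 6 <= sin x.
Proof.
  intros [H0 H4]. destruct (pre_sin_bound x 0 H0 H4) as [H _].
  expand_taylor H. lra.
Qed.

Lemma sin_le_quintic (x : R) : 0 <= x <= 4 -> sin x <= x - x ^ 3 / 6 + x ^ 5 / 120.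
Proof.
  intros [H0 H4]. destruct (pre_sin_bound x 0 H0 H4) as [_ H].
  expand_taylor H. lra.
Qed.

Lemma cos_ge_quadratic (x : R) : 1 - x ^ 2 / 2 <= cos x.
Proof.
  replace x with (2 * (x / 2)) at 2 by field. rewrite cos_2a_sin.
  pose proof (sin_abs_le (x / 2)) as H. apply Rsqr_le_abs_1 in H.
  unfold Rsqr in H. lra.
Qed.

Lemma cos_le_quartic (x : R) : -2 <= x <= 2 -> cos x <= 1 - x ^ 2 / 2 + x ^ 4 / 24.
Proof.
  intros [H0 H4]. destruct (pre_cos_bound x 0 H0 H4) as [_ H].
  expand_taylor H. lra.
Qed.

(** Numerical enclosure of the sine at a rational [c], in a form that [lra] can evaluate. *)
Ltac sin_at c H :=
  pose proof (taylor_sin_bounds c ltac:(lra)) as H;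
  unfold taylor_sin_lower, taylor_sin_upper in H.

(** The sine changes sign at [PI], and its Taylor enclosures at the two rationals have definite
    signs. *)
Lemma PI_bounds : 3.141592 < PI < 3.141593.
Proof.
  pose proof PI_4. pose proof PI2_3_2.
  split.
  - destruct (Rlt_le_dec 3.141592 PI) as [|C]; auto.
    exfalso.
    assert (sin 3.141592 <= 0) by (apply sin_le_0; lra).
    sin_at 3.141592 B. lra.
  - destruct (Rlt_le_dec PI 3.141593) as [|C]; auto.
    exfalso.
    assert (0 <= sin 3.141593) by (apply sin_ge_0; lra).
    sin_at 3.141593 B. lra.
Qed.

Lemma sin_diff_le (x y : R) : Rabs (sin x - sin y) <= Rabs (x - y).
Proof.
  rewrite form4, !Rabs_mult, (Rabs_pos_eq 2) by lra.
  pose proof (COS_bound ((x + y) / 2)) as C.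
  assert (HC : Rabs (cos ((x + y) / 2)) <= 1) by (apply Rabs_le; lra).
  pose proof (sin_abs_le ((x - y) / 2)) as S.
  unfold Rdiv in S at 2. rewrite Rabs_mult, (Rabs_pos_eq (/ 2)) in S by lra.
  pose proof (Rabs_pos (cos ((x + y) / 2))).
  pose proof (Rabs_pos (sin ((x - y) / 2))). nra.
Qed.

(** Carries an enclosure computed at a rational [c] over to an argument known only up to [e]. *)
Lemma sin_bounds_near (c e x : R) :
  c - e <= x <= c + e -> sin c - e <= sin x <= sin c + e.
Proof.
  intros H. pose proof (sin_diff_le x c) as D.
  assert (Rabs (x - c) <= e) by (apply Rabs_le; lra).
  pose proof (Rle_abs (sin x - sin c)). pose proof (Rle_abs (- (sin x - sin c))).
  rewrite Rabs_Ropp in *. lra.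
Qed.

(** [2 * sin (x / 2)] is the chord of an arc [x], and it changes strictly less than the arc.
    Strictness yields the uniqueness of E_1, E_2 and E_4 and excludes a meeting before C_1'. *)
Lemma half_chord_strict (x y : R) :
  x < y -> x - y < 2 * sin (y / 2) - 2 * sin (x / 2) < y - x.
Proof.
  intros H. pose proof (form4 (y / 2) (x / 2)) as F.
  set (c := cos ((y / 2 + x / 2) / 2)) in *.
  pose proof (COS_bound ((y / 2 + x / 2) / 2)) as C. fold c in C.
  set (h := (y / 2 - x / 2) / 2) in *.
  assert (Hh : 0 < h) by (unfold h; lra).
  pose proof (sin_lt_x h Hh).
  assert (- h < sin h).
  { destruct (Rle_lt_dec h 1).
    - pose proof PI2_1. assert (0 < sin h) by (apply sin_gt_0; lra). lra.
    - pose proof (SIN_bound h). lra. }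
  assert (y - x = 4 * h) by (unfold h; lra).
  assert (- h < c * sin h < h) by (destruct (Rle_lt_dec 0 (sin h)); split; nra).
  lra.
Qed.

(** * Distances between points of the circle and of the cuts *)

Lemma distance_pos (A B : point) : 0 <= distance A B.
Proof. unfold distance, dist_euc; apply sqrt_pos. Qed.

Lemma distance_sqr (A B : point) :
  distance A B ^ 2 = (fst A - fst B) ^ 2 + (snd A - snd B) ^ 2.
Proof.
  unfold distance, dist_euc.
  rewrite pow2_sqrt; [unfold Rsqr; ring | apply Rplus_le_le_0_compat; apply Rle_0_sqr].
Qed.

Lemma distance_triangle (A B C : point) :
  distance A C <= distance A B + distance B C.
Proof. apply triangle. Qed.

Lemma distance_sym (A B : point) : distance A B = distance B A.
Proof. apply distance_symm. Qed.

Lemma le_of_sqr_le (x y : R) : 0 <= y -> x ^ 2 <= y ^ 2 -> x <= y.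
Proof. intros. nra. Qed.

Lemma lt_of_sqr_lt (x y : R) : 0 <= y -> x ^ 2 < y ^ 2 -> x < y.
Proof. intros. nra. Qed.

(** All estimates on the cuts start from this squared form, which avoids the root. *)
Lemma distance_circ_cut (s p a m : R) :
  distance (circ (-1) s) (cut 1 p a m) ^ 2 =
  2 + m ^ 2 - 2 * m * sin (p - a) - 2 * cos (s + p) - 2 * m * sin (s + a).
Proof.
  rewrite distance_sqr. unfold cut, circ; cbn [fst snd].
  rewrite sin_minus, cos_plus, sin_plus.
  pose proof (sin2_cos2 s). pose proof (sin2_cos2 p). pose proof (sin2_cos2 a).
  unfold Rsqr in *.
  (* Writing the constant and [m ^ 2] with three sums of squares of sine and cosine leaves a
     polynomial identity. *)
  replace (2 + m ^ 2) with ((sin s * sin s + cos s * cos s)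
    + (sin p * sin p + cos p * cos p) + m ^ 2 * (sin a * sin a + cos a * cos a))
    by (replace (sin s * sin s + cos s * cos s) with 1 by lra;
        replace (sin p * sin p + cos p * cos p) with 1 by lra;
        replace (sin a * sin a + cos a * cos a) with 1 by lra; ring).
  ring.
Qed.

(** The arc lengths are measured from I in opposite directions, so the points are separated by the
    angle [s + r]; it exceeds a full turn once R_2 has passed the exit, whence the absolute
    value. *)
Lemma distance_circ_circ (s r : R) :
  distance (circ (-1) s) (circ 1 r) = 2 * Rabs (sin ((s + r) / 2)).
Proof.
  assert (H : distance (circ (-1) s) (circ 1 r) ^ 2
              = (2 * Rabs (sin ((s + r) / 2))) ^ 2).
  { replace (circ 1 r) with (cut 1 r 0 0)
      by (unfold cut, circ; cbn [fst snd]; f_equal; ring).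
    rewrite distance_circ_cut.
    replace (cos (s + r)) with (cos (2 * ((s + r) / 2))) by (f_equal; field).
    rewrite cos_2a_sin, Rpow_mult_distr, pow2_abs. ring. }
  pose proof (distance_pos (circ (-1) s) (circ 1 r)).
  pose proof (Rabs_pos (sin ((s + r) / 2))).
  apply Rle_antisym; apply le_of_sqr_le; lra.
Qed.

Lemma distance_circ_circ_nonneg (s r : R) :
  0 <= s + r <= 2 * PI ->
  distance (circ (-1) s) (circ 1 r) = 2 * sin ((s + r) / 2).
Proof.
  intros H. rewrite distance_circ_circ, Rabs_pos_eq; auto.
  apply sin_ge_0; lra.
Qed.

(** * Unit speed of the trajectories *)

(** An inequality, because on an arc the straight displacement is shorter than the elapsed time. *)
Definition unit_speed (f : R -> point) : Prop :=
  forall t t', t <= t' -> distance (f t) (f t') <= t' - t.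

Lemma unit_speed_glue (c : R) (f g : R -> point) :
  unit_speed f -> unit_speed g -> f c = g c ->
  unit_speed (fun t => if Rle_dec t c then f t else g t).
Proof.
  intros Hf Hg E t t' Ht.
  destruct (Rle_dec t c), (Rle_dec t' c); auto; try lra.
  eapply Rle_trans; [apply (distance_triangle _ (f c))|].
  specialize (Hf t c r). rewrite E at 2.
  specialize (Hg c t' ltac:(lra)). lra.
Qed.

Lemma unit_speed_shift (c : R) (f : R -> point) :
  unit_speed f -> unit_speed (fun t => f (t + c)).
Proof. intros H t t' Ht. specialize (H (t + c) (t' + c)). lra. Qed.

Lemma unit_speed_ext (f g : R -> point) :
  (forall t, f t = g t) -> unit_speed f -> unit_speed g.
Proof. intros E H t t' Ht. rewrite <- !E. auto. Qed.

Lemma unit_speed_line (x y a b : R) :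
  a ^ 2 + b ^ 2 = 1 -> unit_speed (fun t => (x + t * a, y + t * b)).
Proof.
  intros N t t' Ht. apply le_of_sqr_le; [lra|].
  rewrite distance_sqr; cbn [fst snd]. right.
  replace ((t' - t) ^ 2) with ((t' - t) ^ 2 * (a ^ 2 + b ^ 2)) by (rewrite N; ring).
  ring.
Qed.

Lemma unit_speed_circ (sg : R) : sg ^ 2 = 1 -> unit_speed (circ sg).
Proof.
  intros Hs t t' Ht. apply le_of_sqr_le; [lra|].
  rewrite distance_sqr; unfold circ; cbn [fst snd].
  replace ((sg * sin t - sg * sin t') ^ 2 + (cos t - cos t') ^ 2)
    with (2 - 2 * cos (2 * ((t' - t) / 2))).
  - rewrite cos_2a_sin. pose proof (sin_abs_le ((t' - t) / 2)) as H.
    apply Rsqr_le_abs_1 in H. unfold Rsqr in H. lra.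
  - replace (2 * ((t' - t) / 2)) with (t' - t) by field. rewrite cos_minus.
    pose proof (sin2_cos2 t). pose proof (sin2_cos2 t'). unfold Rsqr in *.
    replace ((sg * sin t - sg * sin t') ^ 2)
      with (sg ^ 2 * (sin t - sin t') ^ 2) by ring.
    rewrite Hs. lra.
Qed.

Definition well_formed (P : params) : Prop :=
  0 <= p1 P <= p2 P /\ p2 P <= PI /\ 0 <= d1 P /\ 0 <= d2 P.

Lemma cut_0 (sg p a : R) : cut sg p a 0 = circ sg p.
Proof. unfold cut, circ; cbn [fst snd]. f_equal; ring. Qed.

Lemma cut_circ (sg p q a l : R) : l = 0 -> p = q -> cut sg p a l = circ sg q.
Proof. intros -> ->. apply cut_0. Qed.

(** The formula of each of the eight pieces has unit speed on the whole time line, and consecutive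
    pieces agree at their common breakpoint. *)
Lemma trajectory_unit_speed (P : params) (sg : R) :
  sg ^ 2 = 1 -> well_formed P -> unit_speed (trajectory P sg).
Proof.
  intros Hs W.
  assert (N : forall a, (- sg * cos a) ^ 2 + sin a ^ 2 = 1).
  { intros a. pose proof (sin2_cos2 a). unfold Rsqr in *.
    replace ((- sg * cos a) ^ 2) with (sg ^ 2 * (cos a * cos a)) by ring.
    rewrite Hs. lra. }
  assert (C0 : forall c, unit_speed (fun t => circ sg (t - c)))
    by (intros; apply (unit_speed_shift (- c)), unit_speed_circ, Hs).
  assert (C : forall p c, unit_speed (fun t => circ sg (p + (t - c)))).
  { intros p c. apply unit_speed_ext with (fun t => circ sg (t - (c - p)));
      [intros t; f_equal; ring | apply C0]. }
  assert (Out : forall p a c, unit_speed (fun t => cut sg p a (t - c))).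
  { intros p a c.
    apply unit_speed_ext with (fun t =>
      (sg * sin p + c * (sg * cos a) + t * (- sg * cos a),
       cos p - c * sin a + t * sin a));
      [| apply unit_speed_line, N].
    intros t. unfold cut, circ; cbn [fst snd]. f_equal; ring. }
  assert (In : forall p a c, unit_speed (fun t => cut sg p a (c - t))).
  { intros p a c.
    apply unit_speed_ext with (fun t =>
      (sg * sin p - c * (sg * cos a) + t * (sg * cos a),
       cos p + c * sin a + t * (- sin a)));
      [| apply unit_speed_line].
    - intros t. unfold cut, circ; cbn [fst snd]. f_equal; ring.
    - rewrite <- (N a). ring. }
  unfold well_formed in W. unfold trajectory.
  unfold cut2_end, cut2_start, cut1_end, cut1_start.
  (* What remains after gluing is the initial segment and the agreement at the seven breakpoints. *)
  repeat apply unit_speed_glue; auto.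
  { apply unit_speed_ext with (fun t => (0 + t * 0, 0 + t * 1));
      [intros; f_equal; ring | apply unit_speed_line; ring]. }
  all: try (destruct Rle_dec; [|lra]).
  all: first
    [ apply cut_circ; lra
    | symmetry; apply cut_circ; lra
    | unfold circ; rewrite Rminus_diag, sin_0, cos_0; f_equal; ring
    | f_equal; lra ].
Qed.

(** * Positions on the successive pieces *)

Ltac unfold_times :=
  unfold cut2_end, cut2_start, cut1_end, cut1_start in *.

Ltac solve_trajectory :=
  unfold well_formed, trajectory in *; unfold_times;
  repeat (destruct Rle_dec; try lra);
  first [ f_equal; lra
        | apply cut_circ; lra
        | symmetry; apply cut_circ; lra
        | unfold circ; f_equal; f_equal; lra ].

(** This and the next lemmas hold on closed pieces; [trajectory] assigns a breakpoint to the earlier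
    piece, hence the separate case at the start of each piece. *)
Lemma trajectory_arc1 (P : params) (sg s : R) :
  well_formed P -> 0 <= s <= p1 P -> trajectory P sg (1 + s) = circ sg s.
Proof.
  intros W H. destruct (Req_dec s 0) as [-> | N].
  - unfold trajectory. destruct Rle_dec; [|lra].
    unfold circ. rewrite sin_0, cos_0. f_equal; ring.
  - solve_trajectory.
Qed.

Lemma trajectory_out1 (P : params) (sg m : R) :
  well_formed P -> 0 <= m <= d1 P ->
  trajectory P sg (cut1_start P + m) = cut sg (p1 P) (alpha1 P) m.
Proof.
  intros W H. destruct (Req_dec m 0) as [-> | N].
  - rewrite cut_0, Rplus_0_r. apply trajectory_arc1; auto.
    unfold well_formed in W; lra.
  - unfold well_formed in *. solve_trajectory.
Qed.

(** The return leg is indexed by the distance [m] still to go. *)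
Lemma trajectory_in1 (P : params) (sg m : R) :
  well_formed P -> 0 <= m <= d1 P ->
  trajectory P sg (cut1_end P - m) = cut sg (p1 P) (alpha1 P) m.
Proof.
  intros W H. destruct (Req_dec m (d1 P)) as [E | N].
  - rewrite <- trajectory_out1 by (auto; lra). f_equal. unfold_times. lra.
  - unfold well_formed in *. solve_trajectory.
Qed.

Lemma trajectory_arc2 (P : params) (sg l : R) :
  well_formed P -> 0 <= l <= p2 P - p1 P ->
  trajectory P sg (cut1_end P + l) = circ sg (p1 P + l).
Proof.
  intros W H. destruct (Req_dec l 0) as [-> | N].
  - rewrite !Rplus_0_r, <- (cut_0 sg (p1 P) (alpha1 P)).
    rewrite <- trajectory_in1; [f_equal; ring | auto | unfold well_formed in W; lra].
  - unfold well_formed in *. solve_trajectory.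
Qed.

Lemma trajectory_out2 (P : params) (sg m : R) :
  well_formed P -> 0 <= m <= d2 P ->
  trajectory P sg (cut2_start P + m) = cut sg (p2 P) (alpha2 P) m.
Proof.
  intros W H. destruct (Req_dec m 0) as [-> | N].
  - rewrite cut_0, Rplus_0_r. unfold cut2_start.
    rewrite trajectory_arc2; [f_equal; ring | auto | unfold well_formed in W; lra].
  - unfold well_formed in *. solve_trajectory.
Qed.

Lemma trajectory_in2 (P : params) (sg m : R) :
  well_formed P -> 0 <= m <= d2 P ->
  trajectory P sg (cut2_end P - m) = cut sg (p2 P) (alpha2 P) m.
Proof.
  intros W H. destruct (Req_dec m (d2 P)) as [E | N].
  - rewrite <- trajectory_out2 by (auto; lra). f_equal. unfold_times. lra.
  - unfold well_formed in *. solve_trajectory.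
Qed.

Lemma trajectory_arc3 (P : params) (sg l : R) :
  well_formed P -> 0 <= l ->
  trajectory P sg (cut2_end P + l) = circ sg (p2 P + l).
Proof.
  intros W H. destruct (Req_dec l 0) as [-> | N].
  - rewrite !Rplus_0_r, <- (cut_0 sg (p2 P) (alpha2 P)).
    rewrite <- trajectory_in2; [f_equal; ring | auto | unfold well_formed in W; lra].
  - unfold well_formed in *. solve_trajectory.
Qed.

(** * Time at which an exit is found *)

(** An exit exactly at [p1] or [p2] is found on the first arrival, before the cut; the artificial
    exits account for the return. *)
Definition find_time (P : params) (s : R) : R :=
  if Rle_dec s (p1 P) then 1 + s
  else if Rle_dec s (p2 P) then 1 + s + 2 * d1 P
  else 1 + s + 2 * d1 P + 2 * d2 P.

(** [2 * sin (p - a)] is the length of the full chord in the direction of the cut, so no cut reaches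
    the circle again. *)
Definition cuts_inside_disk (P : params) : Prop :=
  d1 P < 2 * sin (p1 P - alpha1 P) /\ d2 P < 2 * sin (p2 P - alpha2 P).

Lemma circ_inj (r s : R) :
  0 <= r <= PI -> 0 <= s <= PI -> circ (-1) r = circ (-1) s -> r = s.
Proof.
  intros Hr Hs E. injection E as _ E.
  destruct (Rtotal_order r s) as [L | [L | L]]; auto; exfalso.
  - pose proof (cos_decreasing_1 r s). lra.
  - pose proof (cos_decreasing_1 s r). lra.
Qed.

(** The squared norm of the cut point minus one factors as [m * (m - 2 * sin (p - a))]. *)
Lemma cut_on_circle (p a m s : R) :
  0 <= m < 2 * sin (p - a) -> cut (-1) p a m = circ (-1) s -> m = 0.
Proof.
  intros Hm E. pose proof (sin2_cos2 s) as S. pose proof (sin2_cos2 p) as Sp.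
  pose proof (sin2_cos2 a) as Sa. unfold Rsqr in *.
  rewrite sin_minus in Hm. unfold cut, circ in E; cbn [fst snd] in E.
  injection E as E1 E2.
  assert (X : sin s = sin p - m * cos a) by lra.
  rewrite X, <- E2 in S.
  assert (Y : m * (m - 2 * (sin p * cos a - cos p * sin a)) = 0).
  { replace (m * (m - 2 * (sin p * cos a - cos p * sin a)))
      with (((sin p - m * cos a) * (sin p - m * cos a)
             + (cos p + m * sin a) * (cos p + m * sin a))
            - (sin p * sin p + cos p * cos p)
            + m * m * (1 - (sin a * sin a + cos a * cos a))) by ring.
    rewrite S, Sp, Sa. ring. }
  apply Rmult_integral in Y. lra.
Qed.

Lemma robot1_at_circ (P : params) (s t : R) :
  well_formed P -> cuts_inside_disk P -> on_arc s -> 0 <= t ->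
  robot1 P t = circ (-1) s -> find_time P s <= t.
Proof.
  intros W [I1 I2] Hs Ht E. unfold on_arc in Hs. unfold robot1, trajectory in E.
  pose proof PI_bounds.
  assert (Hcut1 : forall m, 0 <= m <= d1 P ->
    cut (-1) (p1 P) (alpha1 P) m = circ (-1) s -> m = 0 /\ s = p1 P).
  { intros m Hm C. assert (m = 0) by (eapply cut_on_circle; [|exact C]; lra).
    subst m. rewrite cut_0 in C. split; auto. symmetry.
    apply circ_inj; auto. unfold well_formed in W; lra. }
  assert (Hcut2 : forall m, 0 <= m <= d2 P ->
    cut (-1) (p2 P) (alpha2 P) m = circ (-1) s -> m = 0 /\ s = p2 P).
  { intros m Hm C. assert (m = 0) by (eapply cut_on_circle; [|exact C]; lra).
    subst m. rewrite cut_0 in C. split; auto. symmetry.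
    apply circ_inj; auto. unfold well_formed in W; lra. }
  assert (G : forall x, 0 <= x <= PI -> circ (-1) x = circ (-1) s -> x = s)
    by (intros; apply circ_inj; auto).
  unfold well_formed in W. unfold_times.
  repeat destruct Rle_dec in E.
  - injection E as E1 E2. pose proof (sin2_cos2 s) as S. unfold Rsqr in S.
    assert (C1 : cos s = 1) by nra.
    assert (s = 0).
    { apply circ_inj; try lra. unfold circ. rewrite sin_0, cos_0, C1.
      f_equal; lra. }
    subst s. unfold find_time. destruct Rle_dec; lra.
  - apply G in E; [|lra]. unfold find_time. destruct Rle_dec; lra.
  - apply Hcut1 in E; lra.
  - apply Hcut1 in E; [|lra]. unfold find_time. destruct Rle_dec; lra.
  - apply G in E; [|lra]. unfold find_time. repeat destruct Rle_dec; lra.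
  - apply Hcut2 in E; lra.
  - apply Hcut2 in E; [|lra]. unfold find_time. repeat destruct Rle_dec; lra.
  (* On the last piece R_1 may have run past I'; then its arc length exceeds [PI], hence [s], and
     the bound holds anyway. *)
  - set (x := p2 P + (t - _)) in E.
    destruct (Rle_lt_dec x PI) as [L | L].
    + apply G in E; [|unfold x in *; lra]. unfold x in *.
      unfold find_time. repeat destruct Rle_dec; lra.
    + unfold x in *. unfold find_time. repeat destruct Rle_dec; lra.
Qed.

Lemma robot1_find_time (P : params) (s : R) :
  well_formed P -> on_arc s -> robot1 P (find_time P s) = circ (-1) s.
Proof.
  intros W Hs. unfold on_arc in Hs. unfold robot1, find_time.
  assert (W' := W). unfold well_formed in W'.
  destruct Rle_dec; [apply trajectory_arc1; auto; lra|].
  destruct Rle_dec.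
  - replace (1 + s + 2 * d1 P) with (cut1_end P + (s - p1 P)) by (unfold_times; ring).
    rewrite trajectory_arc2 by (auto; lra). f_equal; ring.
  - replace (1 + s + 2 * d1 P + 2 * d2 P) with (cut2_end P + (s - p2 P))
      by (unfold_times; ring).
    rewrite trajectory_arc3 by (auto; lra). f_equal; ring.
Qed.

Lemma found_find_time (P : params) (s : R) :
  well_formed P -> cuts_inside_disk P -> on_arc s ->
  found P (Exit s) (find_time P s).
Proof.
  intros W I Hs. assert (Hs' := Hs). unfold on_arc in Hs'.
  assert (W' := W). unfold well_formed in W'. split; [split|].
  - unfold find_time. repeat destruct Rle_dec; lra.
  - apply robot1_find_time; auto.
  - intros t [Ht E]. apply robot1_at_circ; auto.
Qed.

Lemma found_unique (P : params) (s t0 : R) :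
  well_formed P -> cuts_inside_disk P -> on_arc s ->
  found P (Exit s) t0 -> t0 = find_time P s.
Proof.
  intros W I Hs [A B]. destruct (found_find_time P s W I Hs) as [A' B'].
  apply Rle_antisym; auto.
Qed.

(** * Existence and recognition of the meeting *)

Lemma distance_minus_time_antitone (P : params) (E : point) (t0 u v : R) :
  well_formed P -> u <= v ->
  distance E (robot2 P (t0 + v)) - v <= distance E (robot2 P (t0 + u)) - u.
Proof.
  intros W H.
  pose proof (trajectory_unit_speed P 1 ltac:(ring) W (t0 + u) (t0 + v) ltac:(lra)).
  pose proof (distance_triangle E (robot2 P (t0 + u)) (robot2 P (t0 + v))).
  unfold robot2 in *. lra.
Qed.

(** The gap [distance - u] falls at rate at most 2; together with monotonicity this gives its
    continuity. *)
Lemma distance_minus_time_speed (P : params) (E : point) (t0 u v : R) :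
  well_formed P -> u <= v ->
  distance E (robot2 P (t0 + u)) - u <=
  distance E (robot2 P (t0 + v)) - v + 2 * (v - u).
Proof.
  intros W H.
  pose proof (trajectory_unit_speed P 1 ltac:(ring) W (t0 + u) (t0 + v) ltac:(lra)).
  pose proof (distance_triangle E (robot2 P (t0 + v)) (robot2 P (t0 + u))).
  rewrite (distance_sym (robot2 P (t0 + v))) in *. unfold robot2 in *. lra.
Qed.

(** The meeting time is the supremum of the times at which the gap is positive, which makes it the
    least zero. *)
Lemma meeting_exists (P : params) (E : point) (t0 u : R) :
  well_formed P -> 0 <= u -> distance E (robot2 P (t0 + u)) <= u ->
  exists t, meeting P E t0 t /\ t <= u.
Proof.
  intros W Hu Du.
  set (g := fun v => distance E (robot2 P (t0 + v)) - v).
  assert (Mono : forall v w, v <= w -> g w <= g v)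
    by (intros; apply distance_minus_time_antitone; auto).
  assert (Lip : forall v w, v <= w -> g v <= g w + 2 * (w - v))
    by (intros; apply distance_minus_time_speed; auto).
  assert (G0 : 0 <= g 0).
  { unfold g. pose proof (distance_pos E (robot2 P (t0 + 0))). lra. }
  assert (Gu : g u <= 0) by (unfold g; lra).
  (* Including 0 keeps the set nonempty when the gap vanishes at once. *)
  set (S := fun v => v = 0 \/ (0 <= v /\ 0 < g v)).
  assert (Bd : forall v, S v -> v <= u).
  { intros v [-> | [H0 H1]]; auto.
    destruct (Rle_lt_dec v u) as [|L]; auto.
    specialize (Mono u v ltac:(lra)). lra. }
  destruct (completeness S) as [m [Ub Lub]].
  { exists u. exact Bd. }
  { exists 0. left; auto. }
  assert (Hm0 : 0 <= m) by (apply Ub; left; auto).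
  assert (Above : forall v, m < v -> g v <= 0).
  { intros v Hv. destruct (Rle_lt_dec (g v) 0) as [|L]; auto.
    assert (v <= m) by (apply Ub; right; lra). lra. }
  assert (Below : forall v, 0 <= v < m -> 0 < g v).
  { intros v [H0 H1]. destruct (Rle_lt_dec (g v) 0) as [L|]; auto.
    assert (m <= v); [|lra]. apply Lub. intros w [-> | [W0 W1]]; auto.
    destruct (Rle_lt_dec w v) as [|C]; auto.
    specialize (Mono v w ltac:(lra)). lra. }
  assert (Gm : g m = 0).
  (* A step of at most a quarter of [g m] in absolute value, backward or forward, cannot change the
     sign, as the gap moves at rate at most 2. *)
  { destruct (Rtotal_order (g m) 0) as [L | [L | L]]; auto; exfalso.
    - destruct Hm0 as [Hm0 | <-]; [|lra].
      set (e := Rmin m (- g m / 4)).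
      assert (0 < e) by (unfold e; apply Rmin_glb_lt; lra).
      pose proof (Rmin_l m (- g m / 4)). pose proof (Rmin_r m (- g m / 4)).
      fold e in H0, H1.
      specialize (Lip (m - e) m ltac:(lra)).
      specialize (Below (m - e) ltac:(lra)). lra.
    - specialize (Lip m (m + g m / 4) ltac:(lra)).
      specialize (Above (m + g m / 4) ltac:(lra)). lra. }
  exists m. split; [split; [split|]|].
  - exact Hm0.
  - unfold g in Gm. lra.
  - intros y [Hy Ey]. destruct (Rle_lt_dec m y) as [|L]; auto.
    specialize (Below y ltac:(lra)). unfold g in Below. lra.
  - apply Lub. exact Bd.
Qed.

Lemma meeting_gt (P : params) (E : point) (t0 t v : R) :
  well_formed P -> meeting P E t0 t ->
  v < distance E (robot2 P (t0 + v)) -> v < t.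
Proof.
  intros W [[Ht Et] _] Hv. destruct (Rlt_le_dec v t) as [|L]; auto.
  pose proof (distance_minus_time_antitone P E t0 t v W L). lra.
Qed.

(** Since the gap is nonincreasing, positivity just before [u] excludes every earlier meeting; the
    check can thus stay on one piece of the trajectory. *)
Lemma meeting_intro (P : params) (E : point) (t0 u e : R) :
  well_formed P -> 0 <= u -> 0 < e -> distance E (robot2 P (t0 + u)) = u ->
  (forall h, 0 < h < e -> h <= u -> u - h < distance E (robot2 P (t0 + (u - h)))) ->
  meeting P E t0 u.
Proof.
  intros W Hu He Eu Hs. split; [split; auto|].
  intros y [Hy Ey]. destruct (Rle_lt_dec u y) as [|L]; auto. exfalso.
  set (h := Rmin (u - y) (e / 2)).
  assert (0 < h) by (unfold h; apply Rmin_glb_lt; lra).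
  pose proof (Rmin_l (u - y) (e / 2)). pose proof (Rmin_r (u - y) (e / 2)).
  fold h in H0, H1. specialize (Hs h ltac:(lra) ltac:(lra)).
  pose proof (distance_minus_time_antitone P E t0 y (u - h) W ltac:(lra)). lra.
Qed.

Lemma evacuation_time_le (P : params) (s u : R) :
  well_formed P -> cuts_inside_disk P -> on_arc s -> 0 <= u ->
  distance (circ (-1) s) (robot2 P (find_time P s + u)) <= u ->
  exists T, evacuation_time P (Exit s) T /\ T <= find_time P s + 2 * u.
Proof.
  intros W I Hs Hu D.
  destruct (meeting_exists P _ _ _ W Hu D) as [t [M L]].
  exists (find_time P s + 2 * t). split; [|lra].
  exists (find_time P s), t. split; [apply found_find_time; auto|].
  split; auto.
Qed.

(** * Numerical data on the parameters *)

(** A rational box around the starred parameters, whose angles involve [PI]; the estimates below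
    hold throughout the box. *)
Definition near_star (P : params) : Prop :=
  (2.62666582 <= p1 P <= 2.62666583) /\ (0.698131 <= alpha1 P <= 0.698132) /\
  (0.49001169 <= d1 P <= 0.49001170) /\ (2.97374843 <= p2 P <= 2.97374844) /\
  (0.17354 <= alpha2 P <= 0.173542) /\ (0.16704740 <= d2 P <= 0.16704741).

Lemma near_star_Alg_star : near_star Alg_star.
Proof.
  pose proof PI_bounds. unfold near_star, Alg_star; cbn. lra.
Qed.

Lemma near_star_well_formed (P : params) : near_star P -> well_formed P.
Proof.
  pose proof PI_bounds. unfold near_star, well_formed. lra.
Qed.

Lemma sin_cut1_slope (P : params) :
  near_star P -> 0.93667 <= sin (p1 P - alpha1 P) <= 0.93671.
Proof.
  intros N. unfold near_star in N.
  pose proof (sin_bounds_near 1.92853 0.00001 (p1 P - alpha1 P) ltac:(lra)).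
  sin_at 1.92853 B. lra.
Qed.

Lemma sin_cut2_slope (P : params) :
  near_star P -> 0.33477 <= sin (p2 P - alpha2 P) <= 0.33482.
Proof.
  intros N. unfold near_star in N.
  pose proof (sin_bounds_near 2.80021 0.00001 (p2 P - alpha2 P) ltac:(lra)).
  sin_at 2.80021 B. lra.
Qed.

Lemma near_star_cuts_inside (P : params) : near_star P -> cuts_inside_disk P.
Proof.
  intros N. pose proof (sin_cut1_slope P N). pose proof (sin_cut2_slope P N).
  unfold near_star, cuts_inside_disk in *. lra.
Qed.

(** * The exits E_1, E_2 and E_4 *)

Lemma chord_sum_increasing (p s s' : R) :
  s < s' -> s + 2 * sin ((s + p) / 2) < s' + 2 * sin ((s' + p) / 2).
Proof.
  intros H. pose proof (half_chord_strict (s + p) (s' + p) ltac:(lra)). lra.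
Qed.

Lemma chord_sum_inj (p s s' : R) :
  s + 2 * sin ((s + p) / 2) = s' + 2 * sin ((s' + p) / 2) -> s = s'.
Proof.
  intros E. destruct (Rtotal_order s s') as [L | [L | L]]; auto; exfalso.
  - pose proof (chord_sum_increasing p s s' L). lra.
  - pose proof (chord_sum_increasing p s' s L). lra.
Qed.

Lemma chord_sum_root (p T a b : R) :
  a < b -> a + 2 * sin ((a + p) / 2) < T < b + 2 * sin ((b + p) / 2) ->
  exists s, a <= s <= b /\ s + 2 * sin ((s + p) / 2) = T.
Proof.
  intros H [La Lb].
  destruct (IVT (fun s => s + 2 * sin ((s + p) / 2) - T) a b) as [s [Hs E]].
  - reg.
  - exact H.
  - lra.
  - lra.
  - exists s. split; [exact Hs | lra].
Qed.

(** The equation says that R_1, leaving the exit at time [1 + s], crosses the chord to C_1' by time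
    [1 + p1]; those for E_2 and E_4 are analogous. *)
Lemma E1_root (P : params) :
  near_star P ->
  exists s, 0.629 <= s <= 0.631 /\ s + 2 * sin ((s + p1 P) / 2) = p1 P.
Proof.
  intros N. unfold near_star in N. apply chord_sum_root; [lra|]. split.
  - pose proof (sin_bounds_near 1.62783 0.00001 ((0.629 + p1 P) / 2) ltac:(lra)).
    sin_at 1.62783 B. lra.
  - pose proof (sin_bounds_near 1.62883 0.00001 ((0.631 + p1 P) / 2) ltac:(lra)).
    sin_at 1.62883 B. lra.
Qed.

Lemma E2_root (P : params) :
  near_star P ->
  exists s, 2.589 <= s <= 2.591 /\
    s + 2 * sin ((s + p1 P) / 2) = p1 P + 2 * d1 P.
Proof.
  intros N. unfold near_star in N. apply chord_sum_root; [lra|]. split.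
  - pose proof (sin_bounds_near 2.60783 0.00001 ((2.589 + p1 P) / 2) ltac:(lra)).
    sin_at 2.60783 B. lra.
  - pose proof (sin_bounds_near 2.60883 0.00001 ((2.591 + p1 P) / 2) ltac:(lra)).
    sin_at 2.60883 B. lra.
Qed.

(* The sum varies at rate 1 + cos 2.973 < 0.015 here, which is why the
   parameters are needed to eight digits. *)
Lemma E4_root (P : params) :
  near_star P ->
  exists s, 2.972 <= s <= 2.973 /\
    s + 2 * sin ((s + p2 P) / 2) = p2 P + 2 * d2 P.
Proof.
  intros N. unfold near_star in N. apply chord_sum_root; [lra|]. split.
  - pose proof (sin_bounds_near 2.97287422 0.00000001 ((2.972 + p2 P) / 2) ltac:(lra)).
    sin_at 2.97287422 B. lra.
  - pose proof (sin_bounds_near 2.97337422 0.00000001 ((2.973 + p2 P) / 2) ltac:(lra)).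
    sin_at 2.97337422 B. lra.
Qed.

Lemma find_time_arc1 (P : params) (s : R) : s <= p1 P -> find_time P s = 1 + s.
Proof. intros; unfold find_time; destruct Rle_dec; lra. Qed.

Lemma find_time_arc2 (P : params) (s : R) :
  p1 P < s <= p2 P -> find_time P s = 1 + s + 2 * d1 P.
Proof. intros; unfold find_time; repeat destruct Rle_dec; lra. Qed.

Lemma find_time_arc3 (P : params) (s : R) :
  well_formed P -> p2 P < s -> find_time P s = 1 + s + 2 * d1 P + 2 * d2 P.
Proof.
  intros W H; unfold well_formed in W; unfold find_time.
  repeat destruct Rle_dec; lra.
Qed.

(** The bound [find_time P s <= tau] serves to discard exits found too late on the arc. *)
Lemma picked_up_at_circ (P : params) (s tau r : R) :
  near_star P -> 0 <= r <= PI -> picked_up P s tau (circ 1 r) ->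
  on_arc s /\ find_time P s <= tau /\
  find_time P s + 2 * sin ((s + r) / 2) = tau.
Proof.
  intros N Hr (Hs & t0 & t & F & [[Ht Et] _] & Etau & Er).
  pose proof (near_star_well_formed P N). pose proof (near_star_cuts_inside P N).
  apply found_unique in F; auto. subst t0.
  rewrite Etau, Er in Et. cbn [location] in Et. assert (Hs' := Hs). unfold on_arc in Hs'.
  rewrite distance_circ_circ_nonneg in Et by lra.
  repeat split; auto; lra || apply Hs.
Qed.

Lemma is_E1_equation (P : params) (s : R) :
  near_star P -> is_E1 P s -> s + 2 * sin ((s + p1 P) / 2) = p1 P.
Proof.
  intros N H. pose proof PI_bounds. assert (N' := N). unfold near_star in N'.
  apply picked_up_at_circ in H as (Hs & L & E); auto; [|lra].
  unfold find_time in *. unfold_times. repeat destruct Rle_dec; lra.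
Qed.

Lemma is_E2_equation (P : params) (s : R) :
  near_star P -> is_E2 P s -> s + 2 * sin ((s + p1 P) / 2) = p1 P + 2 * d1 P.
Proof.
  intros N H. pose proof PI_bounds. assert (N' := N). unfold near_star in N'.
  apply picked_up_at_circ in H as (Hs & L & E); auto; [|lra].
  unfold find_time in *. unfold_times. repeat destruct Rle_dec; lra.
Qed.

Lemma is_E4_equation (P : params) (s : R) :
  near_star P -> is_E4 P s -> s + 2 * sin ((s + p2 P) / 2) = p2 P + 2 * d2 P.
Proof.
  intros N H. pose proof PI_bounds. assert (N' := N). unfold near_star in N'.
  apply picked_up_at_circ in H as (Hs & L & E); auto; [|lra].
  unfold find_time in *. unfold_times. repeat destruct Rle_dec; try lra.
  (* An exit found before the first cut is impossible: its chord sum is at most the value at [p1],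
     about 3.30, but would have to be about 4.29. *)
  exfalso.
  assert (s + 2 * sin ((s + p2 P) / 2) <= p1 P + 2 * sin ((p1 P + p2 P) / 2)).
  { destruct r as [r | ->]; [left; apply chord_sum_increasing, r | lra]. }
  pose proof (sin_bounds_near 2.8 0.001 ((p1 P + p2 P) / 2) ltac:(lra)).
  sin_at 2.8 B. lra.
Qed.

Lemma pick_up (P : params) (s t0 u : R) (M : point) :
  on_arc s -> found P (Exit s) t0 -> meeting P (circ (-1) s) t0 u ->
  robot2 P (t0 + u) = M ->
  picked_up P s (t0 + u) M /\ evacuation_time P (Exit s) (t0 + 2 * u).
Proof.
  intros Hs F Mt E. split.
  - split; auto. exists t0, u. auto.
  - exists t0, u. auto.
Qed.

Lemma E1_picked_up (P : params) (s : R) :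
  near_star P -> 0 <= s <= 0.631 -> s + 2 * sin ((s + p1 P) / 2) = p1 P ->
  is_E1 P s /\ evacuation_time P (Exit s) (1 + 2 * p1 P - s).
Proof.
  intros N Hs E. pose proof PI_bounds. assert (N' := N). unfold near_star in N'.
  pose proof (near_star_well_formed P N) as W.
  pose proof (near_star_cuts_inside P N) as I.
  assert (A : on_arc s) by (unfold on_arc; lra).
  pose proof (found_find_time P s W I A) as F.
  rewrite find_time_arc1 in F by lra.
  assert (Pos : forall h, 0 <= h <= p1 P ->
    robot2 P (1 + s + (p1 P - s - h)) = circ 1 (p1 P - h)).
  { intros h Hh. replace (1 + s + (p1 P - s - h)) with (1 + (p1 P - h)) by ring.
    apply trajectory_arc1; auto; lra. }
  assert (Pos0 := Pos 0 ltac:(lra)). rewrite !Rminus_0_r in Pos0.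
  assert (Mt : meeting P (circ (-1) s) (1 + s) (p1 P - s)).
  { apply meeting_intro with (p1 P - s); auto; try lra.
    - rewrite Pos0, distance_circ_circ_nonneg by lra. lra.
    (* Going back by [h] on the arc changes the chord by strictly less than [h]. *)
    - intros h Hh Hh'. rewrite Pos, distance_circ_circ_nonneg by lra.
      pose proof (half_chord_strict (s + (p1 P - h)) (s + p1 P) ltac:(lra)). lra. }
  destruct (pick_up P s (1 + s) (p1 P - s) (circ 1 (p1 P)) A F Mt Pos0) as [U V].
  split.
  - unfold is_E1, cut1_start.
    replace (1 + p1 P) with (1 + s + (p1 P - s)) by ring. exact U.
  - replace (1 + 2 * p1 P - s) with (1 + s + 2 * (p1 P - s)) by ring. exact V.
Qed.

(* A robot returning to [circ 1 p] along its cut does not move straight away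
   from [E], so the exit is out of reach until the cut is completed. *)
Lemma before_cut_end (s p a u m : R) :
  u = 2 * sin ((s + p) / 2) -> sin (p - a) + sin (s + a) < u -> 0 < m <= u ->
  u - m < distance (circ (-1) s) (cut 1 p a m).
Proof.
  intros E H Hm. apply lt_of_sqr_lt; [apply distance_pos|].
  rewrite distance_circ_cut.
  replace (s + p) with (2 * ((s + p) / 2)) by field.
  rewrite cos_2a_sin. nra.
Qed.

Lemma E2_picked_up (P : params) (s : R) :
  near_star P -> 2.589 <= s <= 2.591 ->
  s + 2 * sin ((s + p1 P) / 2) = p1 P + 2 * d1 P ->
  is_E2 P s /\ evacuation_time P (Exit s) (1 + 2 * p1 P + 4 * d1 P - s).
Proof.
  intros N Hs E. pose proof PI_bounds. assert (N' := N). unfold near_star in N'.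
  pose proof (near_star_well_formed P N) as W.
  pose proof (near_star_cuts_inside P N) as I.
  assert (A : on_arc s) by (unfold on_arc; lra).
  pose proof (found_find_time P s W I A) as F.
  rewrite find_time_arc1 in F by lra.
  set (u := p1 P + 2 * d1 P - s).
  assert (Pos : forall h, 0 <= h <= d1 P ->
    robot2 P (1 + s + (u - h)) = cut 1 (p1 P) (alpha1 P) h).
  { intros h Hh. replace (1 + s + (u - h)) with (cut1_end P - h)
      by (unfold u; unfold_times; ring).
    apply trajectory_in1; auto; lra. }
  assert (Pos0 := Pos 0 ltac:(lra)). rewrite !Rminus_0_r, cut_0 in Pos0.
  assert (Mt : meeting P (circ (-1) s) (1 + s) u).
  { apply meeting_intro with (d1 P); auto; try (unfold u; lra).
    - rewrite Pos0, distance_circ_circ_nonneg by lra. unfold u; lra.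
    - intros h Hh Hh'. rewrite Pos by lra. apply before_cut_end; try lra.
      + unfold u; lra.
      + pose proof (sin_cut1_slope P N).
        (* The angle exceeds [PI], so [sin (p1 - alpha1)], below 0.937, has only to be less than
           [u], about 1.017. *)
        assert (sin (s + alpha1 P) <= 0) by (apply sin_le_0; lra).
        unfold u; lra. }
  destruct (pick_up P s (1 + s) u (circ 1 (p1 P)) A F Mt Pos0) as [U V].
  split.
  - unfold is_E2. replace (cut1_end P) with (1 + s + u)
      by (unfold u; unfold_times; ring). exact U.
  - replace (1 + 2 * p1 P + 4 * d1 P - s) with (1 + s + 2 * u)
      by (unfold u; ring). exact V.
Qed.

Lemma E4_picked_up (P : params) (s : R) :
  near_star P -> 2.972 <= s <= 2.973 ->
  s + 2 * sin ((s + p2 P) / 2) = p2 P + 2 * d2 P ->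
  is_E4 P s /\
  evacuation_time P (Exit s) (1 + 2 * p2 P + 2 * d1 P + 4 * d2 P - s).
Proof.
  intros N Hs E. pose proof PI_bounds. assert (N' := N). unfold near_star in N'.
  pose proof (near_star_well_formed P N) as W.
  pose proof (near_star_cuts_inside P N) as I.
  assert (A : on_arc s) by (unfold on_arc; lra).
  pose proof (found_find_time P s W I A) as F.
  rewrite find_time_arc2 in F by lra.
  set (u := p2 P + 2 * d2 P - s).
  assert (Pos : forall h, 0 <= h <= d2 P ->
    robot2 P (1 + s + 2 * d1 P + (u - h)) = cut 1 (p2 P) (alpha2 P) h).
  { intros h Hh. replace (1 + s + 2 * d1 P + (u - h)) with (cut2_end P - h)
      by (unfold u; unfold_times; ring).
    apply trajectory_in2; auto; lra. }
  assert (Pos0 := Pos 0 ltac:(lra)). rewrite !Rminus_0_r, cut_0 in Pos0.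
  assert (Mt : meeting P (circ (-1) s) (1 + s + 2 * d1 P) u).
  { apply meeting_intro with (d2 P); auto; try (unfold u; lra).
    - rewrite Pos0, distance_circ_circ_nonneg by lra. unfold u; lra.
    - intros h Hh Hh'. rewrite Pos by lra. apply before_cut_end; try lra.
      + unfold u; lra.
      + pose proof (sin_cut2_slope P N).
        pose proof (sin_ge_cubic (s + alpha2 P - PI) ltac:(lra)) as S.
        rewrite sin_minus, cos_PI, sin_PI in S.
        assert (B : 0 <= s + alpha2 P - PI <= 0.005) by lra.
        apply (pow_incr _ _ 3) in B.
        unfold u; lra. }
  destruct (pick_up P s (1 + s + 2 * d1 P) u (circ 1 (p2 P)) A F Mt Pos0) as [U V].
  split.
  - unfold is_E4. replace (cut2_end P) with (1 + s + 2 * d1 P + u)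
      by (unfold u; unfold_times; ring). exact U.
  - replace (1 + 2 * p2 P + 2 * d1 P + 4 * d2 P - s) with (1 + s + 2 * d1 P + 2 * u)
      by (unfold u; ring). exact V.
Qed.

(** * Exits whose pick-up point is taken on the circle *)

Definition evacuates_within (P : params) (s T : R) : Prop :=
  exists T', evacuation_time P (Exit s) T' /\ T' <= T.

(** [tau] and [T] enter through equations, so that each can be given in the form of the position
    lemmas and of the candidate times. *)
Lemma evacuates_within_intro (P : params) (s u T tau : R) (M : point) :
  near_star P -> on_arc s -> 0 <= u ->
  tau = find_time P s + u -> T = find_time P s + 2 * u ->
  robot2 P tau = M -> distance (circ (-1) s) M <= u ->
  evacuates_within P s T.
Proof.
  intros N A Hu -> -> <- D.
  apply evacuation_time_le; auto.
  - apply near_star_well_formed, N.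
  - apply near_star_cuts_inside, N.
Qed.

Lemma neg_cos_as_sin (x : R) : - cos x = sin (x - PI / 2).
Proof. rewrite sin_minus, cos_PI2, sin_PI2. ring. Qed.

Lemma neg_cos_bounds (x : R) :
  PI / 2 <= x <= PI ->
  (x - PI / 2) - (x - PI / 2) ^ 3 / 6 <= - cos x <= x - PI / 2.
Proof.
  intros H. pose proof PI_bounds. rewrite neg_cos_as_sin. split.
  - apply sin_ge_cubic; lra.
  - apply sin_le_arg; lra.
Qed.

(* Delaying the discovery by [2l] while advancing the pick-up by [l] along the
   circle shortens the admissible distance by [l] and the chord by about
   [-3 l cos x >= l]. *)
Lemma sin_decrease (x l : R) :
  PI / 2 + 0.6 <= x <= PI -> 0 <= l <= 0.1 ->
  2 * sin (x + 3 * l / 2) <= 2 * sin x - l.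
Proof.
  intros Hx Hl. pose proof PI_bounds. rewrite sin_plus.
  pose proof (sin_ge_cubic (3 * l / 2) ltac:(lra)).
  pose proof (COS_bound (3 * l / 2)).
  assert (0 <= sin x) by (apply sin_ge_0; lra).
  assert (C : 0.5 <= - cos x).
  { pose proof (neg_cos_bounds x ltac:(lra)) as [B _].
    set (y := x - PI / 2) in *.
    assert (0.6 <= y <= 1.571) by (unfold y; lra). nra. }
  assert (1.4 * l <= sin (3 * l / 2)).
  { assert ((3 * l / 2) ^ 3 / 6 <= 0.1 * l); [|lra].
    assert (l ^ 2 <= 0.01) by nra. nra. }
  nra.
Qed.

(** An exit [2 * l] earlier with the same evacuation time allows a pick-up [l] earlier at a distance
    [l] larger. *)
Lemma within_T1_arc (P : params) (s1 s : R) :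
  near_star P -> 0.629 <= s1 <= 0.631 ->
  s1 + 2 * sin ((s1 + p1 P) / 2) = p1 P ->
  0 <= s <= s1 -> evacuates_within P s (1 + 2 * p1 P - s1).
Proof.
  intros N H1 E Hs. pose proof PI_bounds. assert (N' := N). unfold near_star in N'.
  set (l := (s1 - s) / 2). assert (Hl : s = s1 - 2 * l) by (unfold l; field).
  assert (0 <= l <= 0.32) by lra.
  apply evacuates_within_intro with (u := p1 P - s1 + l) (tau := 1 + (p1 P - l))
    (M := circ 1 (p1 P - l)); auto; rewrite ?find_time_arc1 by lra; try lra.
  - unfold on_arc; lra.
  - apply trajectory_arc1; [apply near_star_well_formed, N | lra].
  - rewrite distance_circ_circ_nonneg by lra.
    replace ((s + (p1 P - l)) / 2) with ((s1 + p1 P) / 2 - 3 * l / 2)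
      by (rewrite Hl; field).
    rewrite sin_minus.
    set (x := (s1 + p1 P) / 2) in *.
    assert (0 <= sin x) by (apply sin_ge_0; unfold x; lra).
    (* As [x] is just above [PI / 2], the chord is nearly a diameter and grows by at most
       [0.3 * l]. *)
    pose proof (neg_cos_bounds x ltac:(unfold x; lra)).
    assert (0 <= - cos x <= 0.1).
    { rewrite neg_cos_as_sin. split.
      - apply sin_ge_0; unfold x; lra.
      - rewrite <- neg_cos_as_sin. unfold x in *; lra. }
    pose proof (COS_bound (3 * l / 2)).
    pose proof (sin_le_arg (3 * l / 2) ltac:(lra)). nra.
Qed.

Lemma within_T2_arc (P : params) (s2 s : R) :
  near_star P -> 2.589 <= s2 <= 2.591 ->
  s2 + 2 * sin ((s2 + p1 P) / 2) = p1 P + 2 * d1 P ->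
  s2 <= s <= p1 P -> evacuates_within P s (1 + 2 * p1 P + 4 * d1 P - s2).
Proof.
  intros N H1 E Hs. pose proof PI_bounds. assert (N' := N). unfold near_star in N'.
  set (l := (s - s2) / 2). assert (Hl : s = s2 + 2 * l) by (unfold l; field).
  assert (0 <= l <= 0.02) by lra.
  apply evacuates_within_intro with (u := p1 P + 2 * d1 P - s2 - l)
    (tau := cut1_end P + l) (M := circ 1 (p1 P + l)); auto;
    rewrite ?find_time_arc1 by lra; unfold_times; try lra.
  - unfold on_arc; lra.
  - apply trajectory_arc2; [apply near_star_well_formed, N | lra].
  - rewrite distance_circ_circ_nonneg by lra.
    replace ((s + (p1 P + l)) / 2) with ((s2 + p1 P) / 2 + 3 * l / 2)
      by (rewrite Hl; field).
    pose proof (sin_decrease ((s2 + p1 P) / 2) l ltac:(lra) ltac:(lra)). lra.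
Qed.

Lemma within_T4_arc (P : params) (s4 s : R) :
  near_star P -> 2.972 <= s4 <= 2.973 ->
  s4 + 2 * sin ((s4 + p2 P) / 2) = p2 P + 2 * d2 P ->
  s4 <= s <= p2 P ->
  evacuates_within P s (1 + 2 * p2 P + 2 * d1 P + 4 * d2 P - s4).
Proof.
  intros N H1 E Hs. pose proof PI_bounds. assert (N' := N). unfold near_star in N'.
  set (l := (s - s4) / 2). assert (Hl : s = s4 + 2 * l) by (unfold l; field).
  assert (0 <= l <= 0.01) by lra.
  apply evacuates_within_intro with (u := p2 P + 2 * d2 P - s4 - l)
    (tau := cut2_end P + l) (M := circ 1 (p2 P + l)); auto;
    rewrite ?find_time_arc2 by lra; unfold_times; try lra.
  - unfold on_arc; lra.
  - apply trajectory_arc3; [apply near_star_well_formed, N | lra].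
  - rewrite distance_circ_circ_nonneg by lra.
    replace ((s + (p2 P + l)) / 2) with ((s4 + p2 P) / 2 + 3 * l / 2)
      by (rewrite Hl; field).
    pose proof (sin_decrease ((s4 + p2 P) / 2) l ltac:(lra) ltac:(lra)). lra.
Qed.

(** Both robots are back on the circle simultaneously, so after a further [t] R_2 is at arc length
    [p2 + t]. The sign of the gap at 0.15 and 0.2 brackets [t]. *)
Lemma artificial5_meeting (P : params) :
  near_star P ->
  exists t, 0.15 <= t <= 0.2 /\ 2 * sin (p2 P + t / 2) = t /\
    evacuation_time P Artificial5 (cut2_end P + 2 * t).
Proof.
  intros N. pose proof PI_bounds. assert (N' := N). unfold near_star in N'.
  pose proof (near_star_well_formed P N) as W.
  assert (Pos : forall v, 0 <= v <= 0.2 ->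
    distance (circ (-1) (p2 P)) (robot2 P (cut2_end P + v))
    = 2 * sin (p2 P + v / 2)).
  { intros v Hv. unfold robot2. rewrite trajectory_arc3 by (auto; lra).
    rewrite distance_circ_circ_nonneg by lra. f_equal; f_equal; field. }
  destruct (meeting_exists P (circ (-1) (p2 P)) (cut2_end P) 0.2 W) as [t [Mt L]].
  - lra.
  - rewrite Pos by lra. rewrite <- sin_PI_x.
    pose proof (sin_le_arg (PI - (p2 P + 0.2 / 2)) ltac:(lra)). lra.
  - assert (0.15 < t).
    { apply (meeting_gt _ _ _ _ _ W Mt). rewrite Pos by lra. rewrite <- sin_PI_x.
      set (x := PI - (p2 P + 0.15 / 2)). assert (0.09 <= x <= 0.1) by (unfold x; lra).
      pose proof (sin_ge_cubic x ltac:(lra)). nra. }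
    exists t. split; [lra|]. split.
    + rewrite <- Pos by lra. apply Mt.
    + exists (cut2_end P), t. split; [reflexivity|]. split; [exact Mt | reflexivity].
Qed.

Lemma within_T5_arc (P : params) (t s : R) :
  near_star P -> 0.15 <= t <= 0.2 -> 2 * sin (p2 P + t / 2) = t ->
  p2 P < s <= PI -> evacuates_within P s (cut2_end P + 2 * t).
Proof.
  intros N H1 E Hs. pose proof PI_bounds. assert (N' := N). unfold near_star in N'.
  pose proof (near_star_well_formed P N) as W.
  set (l := (s - p2 P) / 2). assert (Hl : s = p2 P + 2 * l) by (unfold l; field).
  assert (0 <= l <= 0.1) by lra.
  apply evacuates_within_intro with (u := t - l)
    (tau := cut2_end P + (t + l)) (M := circ 1 (p2 P + (t + l))); auto;
    rewrite ?find_time_arc3 by (auto; lra); unfold_times; try lra.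
  - unfold on_arc; lra.
  - apply trajectory_arc3; auto; lra.
  - rewrite distance_circ_circ.
    destruct (Rle_lt_dec ((s + (p2 P + (t + l))) / 2) PI) as [Le | Gt].
    + rewrite Rabs_pos_eq by (apply sin_ge_0; lra).
      replace ((s + (p2 P + (t + l))) / 2) with (p2 P + t / 2 + 3 * l / 2)
        by (rewrite Hl; field).
      pose proof (sin_decrease (p2 P + t / 2) l ltac:(lra) ltac:(lra)). lra.
    + (* R_2 has already passed the exit *)
      rewrite <- Rabs_Ropp.
      replace (- sin ((s + (p2 P + (t + l))) / 2))
        with (sin ((s + (p2 P + (t + l))) / 2 - PI))
        by (rewrite sin_minus, cos_PI, sin_PI; ring).
      rewrite Rabs_pos_eq by (apply sin_ge_0; lra).
      pose proof (sin_le_arg ((s + (p2 P + (t + l))) / 2 - PI) ltac:(lra)). lra.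
Qed.

(** * Exits whose pick-up point is taken on a cut *)

(** For [s] met at the start of the cut. After squaring, [l ^ 2] cancels and the difference of
    cosines becomes a product containing [sin l]; the remaining condition can be divided by [l]. *)
Lemma distance_cut_outbound (s p a u l : R) :
  u = 2 * sin ((s + p) / 2) ->
  0 <= - 2 * sin (s + p + l) * sin l
       + l * (sin (p - a) + sin (s + 2 * l + a) - u) ->
  0 <= u - l -> distance (circ (-1) (s + 2 * l)) (cut 1 p a l) <= u - l.
Proof.
  intros E H Hu. apply le_of_sqr_le; auto. rewrite distance_circ_cut.
  pose proof (form2 (s + 2 * l + p) (s + p)) as F.
  replace ((s + 2 * l + p - (s + p)) / 2) with l in F by field.
  replace ((s + 2 * l + p + (s + p)) / 2) with (s + p + l) in F by field.
  assert (u ^ 2 = 2 - 2 * cos (s + p)).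
  { replace (s + p) with (2 * ((s + p) / 2)) by field.
    rewrite cos_2a_sin, E. ring. }
  lra.
Qed.

(** Counterpart for [s] met at the end of the cut: going back along the return leg, the allowed
    distance grows by [l]. *)
Lemma distance_cut_inbound (s p a u l : R) :
  u = 2 * sin ((s + p) / 2) ->
  0 <= 2 * sin (s + p - l) * sin l
       + l * (u + sin (p - a) + sin (s - 2 * l + a)) ->
  0 <= u + l -> distance (circ (-1) (s - 2 * l)) (cut 1 p a l) <= u + l.
Proof.
  intros E H Hu. apply le_of_sqr_le; auto. rewrite distance_circ_cut.
  pose proof (form2 (s + p) (s - 2 * l + p)) as F.
  replace ((s + p - (s - 2 * l + p)) / 2) with l in F by field.
  replace ((s + p + (s - 2 * l + p)) / 2) with (s + p - l) in F by field.
  assert (u ^ 2 = 2 - 2 * cos (s + p)).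
  { replace (s + p) with (2 * ((s + p) / 2)) by field.
    rewrite cos_2a_sin, E. ring. }
  lra.
Qed.

Lemma within_T1_cut1 (P : params) (s1 s : R) :
  near_star P -> 0.629 <= s1 <= 0.631 ->
  s1 + 2 * sin ((s1 + p1 P) / 2) = p1 P ->
  s1 <= s <= s1 + 2 * d1 P -> evacuates_within P s (1 + 2 * p1 P - s1).
Proof.
  intros N H1 E Hs. pose proof PI_bounds. assert (N' := N). unfold near_star in N'.
  set (l := (s - s1) / 2). assert (Hl : s = s1 + 2 * l) by (unfold l; field).
  assert (0 <= l <= d1 P) by lra. clearbody l. subst s.
  apply evacuates_within_intro with (u := p1 P - s1 - l)
    (tau := cut1_start P + l) (M := cut 1 (p1 P) (alpha1 P) l); auto;
    rewrite ?find_time_arc1 by lra; unfold_times; try lra.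
  - unfold on_arc; lra.
  - apply trajectory_out1; [apply near_star_well_formed, N | lra].
  - apply distance_cut_outbound; try lra.
    pose proof (sin_cut1_slope P N).
    (* Shifts by [PI] and [PI / 2] move the angles close enough to zero for low-degree bounds. *)
    replace (-2 * sin (s1 + p1 P + l)) with (2 * sin (s1 + p1 P + l - PI))
      by (rewrite (sin_minus _ PI), cos_PI, sin_PI; ring).
    replace (sin (s1 + 2 * l + alpha1 P))
      with (cos (PI / 2 - (s1 + 2 * l + alpha1 P)))
      by apply cos_shift.
    set (x := s1 + p1 P + l - PI). set (y := PI / 2 - (s1 + 2 * l + alpha1 P)).
    assert (0.11 + l <= x <= 0.62) by (unfold x; lra).
    assert (0.24 - 2 * l <= y <= 0.245 - 2 * l) by (unfold y; lra).
    assert (0.93 * (0.11 + l) <= sin x).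
    { pose proof (sin_ge_cubic x ltac:(lra)). nra. }
    assert (0.95 * l <= sin l).
    { pose proof (sin_ge_cubic l ltac:(lra)). nra. }
    pose proof (cos_ge_quadratic y).
    assert (y ^ 2 <= (0.245 - 2 * l) ^ 2 + 0.01).
    { assert (Z : y = 0.245 - 2 * l - (0.245 - 2 * l - y)) by ring.
      set (z := 0.245 - 2 * l - y) in *. assert (0 <= z <= 0.005) by (unfold z; lra).
      rewrite Z. nra. }
    assert (0.93 * (0.11 + l) * (0.95 * l) <= sin x * sin l)
      by (apply Rmult_le_compat; lra).
    (* The target divided by [l], with each factor replaced by its rational bound. *)
    assert (0 <= 2 * 0.93 * 0.95 * (0.11 + l) + 0.93667
      + (1 - ((0.245 - 2 * l) ^ 2 + 0.01) / 2) - (p1 P - s1)) by nra.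
    nra.
Qed.

(** From the cubic bound with [0.84 / 6 = 0.14]; one formula serves both signs of [w]. *)
Lemma sin_ge_quadratic (w : R) : -1 <= w <= 0.84 -> w - 0.14 * w ^ 2 <= sin w.
Proof.
  intros H. destruct (Rle_lt_dec 0 w).
  - pose proof (sin_ge_cubic w ltac:(lra)). nra.
  - pose proof (sin_le_arg (- w) ltac:(lra)) as S. rewrite sin_neg in S. nra.
Qed.

Lemma within_T2_cut1 (P : params) (s2 s : R) :
  near_star P -> 2.589 <= s2 <= 2.591 ->
  s2 + 2 * sin ((s2 + p1 P) / 2) = p1 P + 2 * d1 P ->
  s2 - 2 * d1 P <= s <= s2 ->
  evacuates_within P s (1 + 2 * p1 P + 4 * d1 P - s2).
Proof.
  intros N H1 E Hs. pose proof PI_bounds. assert (N' := N). unfold near_star in N'.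
  set (l := (s2 - s) / 2). assert (Hl : s = s2 - 2 * l) by (unfold l; field).
  assert (0 <= l <= d1 P) by lra. clearbody l. subst s.
  apply evacuates_within_intro with (u := p1 P + 2 * d1 P - s2 + l)
    (tau := cut1_end P - l) (M := cut 1 (p1 P) (alpha1 P) l); auto;
    rewrite ?find_time_arc1 by lra; unfold_times; try lra.
  - unfold on_arc; lra.
  - apply trajectory_in1; [apply near_star_well_formed, N | lra].
  - apply distance_cut_inbound; try lra.
    pose proof (sin_cut1_slope P N).
    set (z := s2 + p1 P - 3 * (PI / 2)).
    replace (sin (s2 + p1 P - l)) with (- cos (z - l)).
    2: { unfold z. replace (s2 + p1 P - 3 * (PI / 2) - l)
           with (s2 + p1 P - l - 3 * (PI / 2)) by ring.
         rewrite cos_minus, cos_3PI2, sin_3PI2. ring. }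
    set (w := 2 * l - (s2 + alpha1 P - PI)).
    replace (s2 - 2 * l + alpha1 P) with (PI - w) by (unfold w; ring).
    rewrite sin_PI_x, cos_minus.
    assert (0.503 <= z <= 0.506) by (unfold z; lra).
    assert (2 * l - 0.15 <= w <= 2 * l - 0.145) by (unfold w; lra).
    pose proof (sin_ge_quadratic w ltac:(lra)).
    (* A bound linear in [l], so that [lra] can settle the inequality divided by [l]. *)
    assert (w ^ 2 <= 0.84 * (2 * l) + 0.0225).
    { assert (-0.15 <= w) by lra. destruct (Rle_lt_dec 0 w); nra. }
    assert (0 <= cos z <= 0.877).
    { pose proof (cos_ge_quadratic z). pose proof (cos_le_quartic z ltac:(lra)).
      assert (0.253 <= z ^ 2 <= 0.2561) by (split; nra).
      replace (z ^ 4) with (z ^ 2 * z ^ 2) in * by ring. nra. }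
    pose proof (sin_le_arg z ltac:(lra)). pose proof (COS_bound l).
    assert (0 <= sin z) by (apply sin_ge_0; lra).
    assert (0 <= sin l <= l) by (split; [apply sin_ge_0 | apply sin_le_arg]; lra).
    assert (cos z * cos l + sin z * sin l <= 0.877 + 0.506 * l) by nra.
    assert ((cos z * cos l + sin z * sin l) * sin l <= (0.877 + 0.506 * l) * l).
    { apply Rle_trans with ((0.877 + 0.506 * l) * sin l);
        [apply Rmult_le_compat_r | apply Rmult_le_compat_l]; lra. }
    assert (0 <= - 2 * (0.877 + 0.506 * l)
      + (p1 P + 2 * d1 P - s2 + sin (p1 P - alpha1 P) + sin w)) by lra.
    nra.
Qed.

Lemma within_T4_cut2 (P : params) (s4 s : R) :
  near_star P -> 2.972 <= s4 <= 2.973 ->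
  s4 + 2 * sin ((s4 + p2 P) / 2) = p2 P + 2 * d2 P ->
  s4 - 2 * d2 P <= s <= s4 ->
  evacuates_within P s (1 + 2 * p2 P + 2 * d1 P + 4 * d2 P - s4).
Proof.
  intros N H1 E Hs. pose proof PI_bounds. assert (N' := N). unfold near_star in N'.
  set (l := (s4 - s) / 2). assert (Hl : s = s4 - 2 * l) by (unfold l; field).
  assert (0 <= l <= d2 P) by lra. clearbody l. subst s.
  apply evacuates_within_intro with (u := p2 P + 2 * d2 P - s4 + l)
    (tau := cut2_end P - l) (M := cut 1 (p2 P) (alpha2 P) l); auto;
    rewrite ?find_time_arc2 by lra; unfold_times; try lra.
  - unfold on_arc; lra.
  - apply trajectory_in2; [apply near_star_well_formed, N | lra].
  - apply distance_cut_inbound; try lra.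
    pose proof (sin_cut2_slope P N).
    (* [s4 + p2] falls short of a full turn by [k], about 0.337. *)
    set (k := 2 * PI - s4 - p2 P).
    replace (sin (s4 + p2 P - l)) with (- sin (k + l)).
    2: { unfold k. replace (2 * PI - s4 - p2 P + l)
           with (2 * PI - (s4 + p2 P - l)) by ring.
         rewrite sin_minus, cos_2PI, sin_2PI. ring. }
    set (w := 2 * l - (s4 + alpha2 P - PI)).
    replace (s4 - 2 * l + alpha2 P) with (PI - w) by (unfold w; ring).
    rewrite sin_PI_x, sin_plus.
    assert (0.3364 <= k <= 0.3375) by (unfold k; lra).
    assert (2 * l - 0.005 <= w <= 2 * l) by (unfold w; lra).
    assert (0.3364 ^ 2 <= k ^ 2) by (apply pow_incr; lra).
    assert (k ^ 2 <= 0.3375 ^ 2) by (apply pow_incr; lra).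
    assert (k ^ 4 <= 0.3375 ^ 4) by (apply pow_incr; lra).
    assert (0 <= cos k <= 0.9441).
    { pose proof (cos_ge_quadratic k). pose proof (cos_le_quartic k ltac:(lra)). lra. }
    assert (sin k <= k - 0.00627).
    { pose proof (sin_le_quintic k ltac:(lra)).
      assert (0.3364 ^ 3 <= k ^ 3) by (apply pow_incr; lra).
      assert (k ^ 5 <= 0.3375 ^ 5) by (apply pow_incr; lra). lra. }
    assert (w - 0.04 * l <= sin w).
    { destruct (Rle_lt_dec 0 w).
      - pose proof (sin_ge_cubic w ltac:(lra)).
        assert (w ^ 2 <= 0.3342 ^ 2) by (apply pow_incr; lra).
        replace (w ^ 3) with (w * w ^ 2) in * by ring.
        assert (w * w ^ 2 <= w * 0.3342 ^ 2) by (apply Rmult_le_compat_l; lra).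
        lra.
      - pose proof (sin_le_arg (- w) ltac:(lra)) as S. rewrite sin_neg in S. lra. }
    pose proof (COS_bound l).
    assert (0 <= sin k) by (apply sin_ge_0; lra).
    assert (0 <= sin l <= l) by (split; [apply sin_ge_0 | apply sin_le_arg]; lra).
    assert (sin k * cos l + cos k * sin l <= k - 0.00627 + 0.9441 * l) by nra.
    assert ((sin k * cos l + cos k * sin l) * sin l <= (k - 0.00627 + 0.9441 * l) * l).
    { apply Rle_trans with ((k - 0.00627 + 0.9441 * l) * sin l);
        [apply Rmult_le_compat_r | apply Rmult_le_compat_l]; lra. }
    (* [s4] cancels once [k] and [w] are unfolded, and only about 0.004 is left at [l = 0]; hence
       the sharp constants above. *)
    assert (0 <= - 2 * (k - 0.00627 + 0.9441 * l)
      + (p2 P + 2 * d2 P - s4 + sin (p2 P - alpha2 P) + sin w))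
      by (unfold k, w in *; lra).
    nra.
Qed.

(** [alpha2] nearly equals [(p2 - p1) / 2]: the second cut of R_2 heads almost straight for C_1.
    Hence [p2 - alpha2], [(p1 + p2) / 2] and [p1 + alpha2] share one enclosure. *)
Lemma sin_half_sum (P : params) :
  near_star P -> 0.33477 <= sin ((p1 P + p2 P) / 2) <= 0.33482.
Proof.
  intros N. unfold near_star in N.
  pose proof (sin_bounds_near 2.80021 0.00001 ((p1 P + p2 P) / 2) ltac:(lra)).
  sin_at 2.80021 B. lra.
Qed.

Lemma sin_cut2_direction (P : params) :
  near_star P -> 0.33477 <= sin (p1 P + alpha2 P) <= 0.33482.
Proof.
  intros N. unfold near_star in N.
  pose proof (sin_bounds_near 2.80021 0.00001 (p1 P + alpha2 P) ltac:(lra)).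
  sin_at 2.80021 B. lra.
Qed.

(** R_2 is met on the outbound leg of its second cut; the sign of the gap at depths 0.161 and 0.1615
    brackets [m]. *)
Lemma artificial3_meeting (P : params) :
  near_star P ->
  exists m, 0.161 <= m <= 0.1615 /\
    distance (circ (-1) (p1 P)) (cut 1 (p2 P) (alpha2 P) m) = p2 P - p1 P + m /\
    evacuation_time P Artificial3 (cut1_end P + 2 * (p2 P - p1 P + m)).
Proof.
  intros N. assert (N' := N). unfold near_star in N'.
  pose proof (near_star_well_formed P N) as W.
  assert (Pos : forall m, 0 <= m <= d2 P ->
    robot2 P (cut1_end P + (p2 P - p1 P + m)) = cut 1 (p2 P) (alpha2 P) m).
  { intros m Hm. replace (cut1_end P + (p2 P - p1 P + m)) with (cut2_start P + m)
      by (unfold_times; ring).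
    apply trajectory_out2; auto. }
  assert (C : 0.7756 <= cos (p1 P + p2 P) <= 0.77588).
  { replace (p1 P + p2 P) with (2 * ((p1 P + p2 P) / 2)) by field.
    rewrite cos_2a_sin. pose proof (sin_half_sum P N). nra. }
  pose proof (sin_cut2_slope P N). pose proof (sin_cut2_direction P N).
  destruct (meeting_exists P (circ (-1) (p1 P)) (cut1_end P)
    (p2 P - p1 P + 0.1615) W) as [t [Mt L]].
  - lra.
  - rewrite Pos by lra. apply le_of_sqr_le; [lra|].
    rewrite distance_circ_cut. nra.
  - assert (p2 P - p1 P + 0.161 < t).
    { apply (meeting_gt _ _ _ _ _ W Mt). rewrite Pos by lra.
      apply lt_of_sqr_lt; [apply distance_pos|].
      rewrite distance_circ_cut. nra. }
    exists (t - (p2 P - p1 P)). split; [lra|].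
    assert (Et : p2 P - p1 P + (t - (p2 P - p1 P)) = t) by ring.
    split.
    + rewrite <- Pos by lra. rewrite Et. apply Mt.
    + rewrite Et. exists (cut1_end P), t.
      split; [reflexivity|]. split; [exact Mt | reflexivity].
Qed.

(** The motion starts at depth [m] instead of 0, so the estimate is redone by subtracting the
    squared equality at [l = 0]. *)
Lemma within_T3_cut2 (P : params) (m s : R) :
  near_star P -> 0.161 <= m <= 0.1615 ->
  distance (circ (-1) (p1 P)) (cut 1 (p2 P) (alpha2 P) m) = p2 P - p1 P + m ->
  p1 P < s <= p1 P + 2 * (d2 P - m) ->
  evacuates_within P s (cut1_end P + 2 * (p2 P - p1 P + m)).
Proof.
  intros N Hm E Hs. pose proof PI_bounds. assert (N' := N). unfold near_star in N'.
  set (l := (s - p1 P) / 2). assert (Hl : s = p1 P + 2 * l) by (unfold l; field).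
  assert (0 <= l <= d2 P - m) by lra. clearbody l. subst s.
  apply evacuates_within_intro with (u := p2 P - p1 P + m - l)
    (tau := cut2_start P + (m + l)) (M := cut 1 (p2 P) (alpha2 P) (m + l)); auto;
    rewrite ?find_time_arc2 by lra; unfold_times; try lra.
  - unfold on_arc; lra.
  - apply trajectory_out2; [apply near_star_well_formed, N | lra].
  - apply le_of_sqr_le; [lra|]. apply (f_equal (fun x => x ^ 2)) in E.
    rewrite distance_circ_cut in *.
    pose proof (form2 (p1 P + 2 * l + p2 P) (p1 P + p2 P)) as F2.
    replace ((p1 P + 2 * l + p2 P - (p1 P + p2 P)) / 2) with l in F2 by field.
    replace ((p1 P + 2 * l + p2 P + (p1 P + p2 P)) / 2) with (p1 P + p2 P + l)
      in F2 by field.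
    pose proof (form4 (p1 P + 2 * l + alpha2 P) (p1 P + alpha2 P)) as F4.
    replace ((p1 P + 2 * l + alpha2 P - (p1 P + alpha2 P)) / 2) with l in F4 by field.
    replace ((p1 P + 2 * l + alpha2 P + (p1 P + alpha2 P)) / 2)
      with (p1 P + alpha2 P + l) in F4 by field.
    pose proof (sin_cut2_slope P N) as SA.
    assert (SB : 0.3 <= sin (p1 P + 2 * l + alpha2 P)).
    { pose proof (sin_bounds_near 2.8 0.015 (p1 P + 2 * l + alpha2 P) ltac:(lra)).
      sin_at 2.8 B. lra. }
    assert (SC : sin (p1 P + p2 P + l) <= - 0.6).
    { set (x := 2 * PI - (p1 P + p2 P + l)).
      replace (sin (p1 P + p2 P + l)) with (- sin x)
        by (unfold x; rewrite sin_minus, cos_2PI, sin_2PI; ring).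
      assert (0.67 <= x <= 0.69) by (unfold x; lra).
      pose proof (sin_ge_cubic x ltac:(lra)).
      assert (x ^ 3 <= 0.69 ^ 3) by (apply pow_incr; lra). lra. }
    pose proof (COS_bound (p1 P + alpha2 P + l)) as SD.
    assert (SL : 0.99 * l <= sin l <= l).
    { split; [|apply sin_le_arg; lra].
      pose proof (sin_ge_cubic l ltac:(lra)). nra. }
    set (A := sin (p2 P - alpha2 P)) in *.
    set (B := sin (p1 P + 2 * l + alpha2 P)) in *.
    set (C := sin (p1 P + p2 P + l)) in *.
    set (D := cos (p1 P + alpha2 P + l)) in *.
    (* Half the difference of the squares; the term in [C] dominates. *)
    assert (K : 0 <= l * (A + B - (p2 P - p1 P) - 2 * m)
                 + (- 2 * C + 2 * m * D) * sin l).
    { assert (-0.17 <= m * D) by nra.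
      assert (0.8 * (0.99 * l) <= (- 2 * C + 2 * m * D) * sin l)
        by (apply Rmult_le_compat; lra).
      assert (l * (-0.2) <= l * (A + B - (p2 P - p1 P) - 2 * m))
        by (apply Rmult_le_compat_l; lra).
      lra. }
    assert (F4' : m * (B - sin (p1 P + alpha2 P)) = m * (2 * D * sin l))
      by (rewrite F4; ring).
    lra.
Qed.

(** * Exits met near the turning points *)

Lemma evacuates_within_mono (P : params) (s T T' : R) :
  T <= T' -> evacuates_within P s T -> evacuates_within P s T'.
Proof. intros L (T0 & E & H). exists T0. split; auto; lra. Qed.

(* Covers the turning point of the first cut, where the estimates from E_1
   and from E_2 need not overlap. *)
Lemma within_turn1 (P : params) (s : R) :
  near_star P -> 1.608 <= s <= 1.612 -> evacuates_within P s 5.6.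
Proof.
  intros N Hs. pose proof PI_bounds. assert (N' := N). unfold near_star in N'.
  apply evacuates_within_mono with (1 + 2 * p1 P + 0.9 - s); [lra|].
  apply evacuates_within_intro with (u := p1 P + 0.45 - s)
    (tau := cut1_start P + 0.45) (M := cut 1 (p1 P) (alpha1 P) 0.45); auto;
    rewrite ?find_time_arc1 by lra; unfold_times; try lra.
  - unfold on_arc; lra.
  - apply trajectory_out1; [apply near_star_well_formed, N | lra].
  - apply le_of_sqr_le; [lra|]. rewrite distance_circ_cut.
    pose proof (sin_cut1_slope P N).
    assert (0.7 <= sin (s + alpha1 P)).
    { rewrite <- sin_PI_x. set (x := PI - (s + alpha1 P)).
      assert (0.82 <= x <= 0.84) by (unfold x; lra).
      pose proof (sin_ge_cubic x ltac:(lra)).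
      assert (x ^ 3 <= 0.84 ^ 3) by (apply pow_incr; lra). lra. }
    assert (-0.5 <= cos (s + p1 P)).
    { pose proof (sin_le_arg (3 * (PI / 2) - (s + p1 P)) ltac:(lra)) as S.
      rewrite sin_minus, sin_3PI2, cos_3PI2 in S. lra. }
    nra.
Qed.

(** Fills the gap between the exits bounded through the artificial E_3 and those bounded through
    E_4; 5.62 is just below the time of the former. *)
Lemma within_turn2 (P : params) (s : R) :
  near_star P -> 2.6377 <= s <= 2.639 -> evacuates_within P s 5.62.
Proof.
  intros N Hs. pose proof PI_bounds. assert (N' := N). unfold near_star in N'.
  apply evacuates_within_mono with (1 + 2 * d1 P + 2 * p2 P + 0.328 - s); [lra|].
  apply evacuates_within_intro with (u := p2 P + 0.164 - s)
    (tau := cut2_start P + 0.164) (M := cut 1 (p2 P) (alpha2 P) 0.164); auto;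
    rewrite ?find_time_arc2 by lra; unfold_times; try lra.
  - unfold on_arc; lra.
  - apply trajectory_out2; [apply near_star_well_formed, N | lra].
  - apply le_of_sqr_le; [lra|]. rewrite distance_circ_cut.
    pose proof (sin_cut2_slope P N).
    pose proof (sin_bounds_near 2.8119 0.0007 (s + alpha2 P) ltac:(lra)).
    sin_at 2.8119 B.
    assert (0.322 <= sin (s + alpha2 P)) by lra. clear B.
    pose proof (sin_bounds_near 2.80605 0.0004 ((s + p2 P) / 2) ltac:(lra)).
    sin_at 2.80605 B.
    assert (0 <= sin ((s + p2 P) / 2) <= 0.32972) by lra. clear B.
    replace (s + p2 P) with (2 * ((s + p2 P) / 2)) by field.
    rewrite cos_2a_sin. nra.
Qed.

(** * Covering the arc and comparing the candidates *)

Lemma every_exit_bounded (P : params) (s1 s2 s4 m t : R) (e : exit) :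
  near_star P ->
  0.629 <= s1 <= 0.631 -> s1 + 2 * sin ((s1 + p1 P) / 2) = p1 P ->
  2.589 <= s2 <= 2.591 -> s2 + 2 * sin ((s2 + p1 P) / 2) = p1 P + 2 * d1 P ->
  2.972 <= s4 <= 2.973 -> s4 + 2 * sin ((s4 + p2 P) / 2) = p2 P + 2 * d2 P ->
  0.161 <= m <= 0.1615 ->
  distance (circ (-1) (p1 P)) (cut 1 (p2 P) (alpha2 P) m) = p2 P - p1 P + m ->
  evacuation_time P Artificial3 (cut1_end P + 2 * (p2 P - p1 P + m)) ->
  0.15 <= t <= 0.2 -> 2 * sin (p2 P + t / 2) = t ->
  evacuation_time P Artificial5 (cut2_end P + 2 * t) ->
  admissible e ->
  exists T, evacuation_time P e T /\
    (T <= 1 + 2 * p1 P - s1 \/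
     T <= 1 + 2 * p1 P + 4 * d1 P - s2 \/
     T <= cut1_end P + 2 * (p2 P - p1 P + m) \/
     T <= 1 + 2 * p2 P + 2 * d1 P + 4 * d2 P - s4 \/
     T <= cut2_end P + 2 * t).
Proof.
  intros N H1 E1 H2 E2 H4 E4 Hm E3 A3 Ht E5 A5 A.
  assert (N' := N). unfold near_star in N'.
  destruct e as [s | |]; [| eexists; split; [exact A3 | lra]
                          | eexists; split; [exact A5 | lra]].
  cbn in A. unfold on_arc in A.
  destruct (Rle_lt_dec s s1).
  { destruct (within_T1_arc P s1 s) as (T & ? & ?); auto; try lra.
    exists T; split; auto. }
  destruct (Rle_lt_dec s (s1 + 2 * d1 P)).
  { destruct (within_T1_cut1 P s1 s) as (T & ? & ?); auto; try lra.
    exists T; split; auto. }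
  destruct (Rlt_le_dec s (s2 - 2 * d1 P)).
  { destruct (within_turn1 P s) as (T & ? & ?); auto; try lra.
    exists T; split; auto. left; lra. }
  destruct (Rle_lt_dec s s2).
  { destruct (within_T2_cut1 P s2 s) as (T & ? & ?); auto; try lra.
    exists T; split; auto. }
  destruct (Rle_lt_dec s (p1 P)).
  { destruct (within_T2_arc P s2 s) as (T & ? & ?); auto; try lra.
    exists T; split; auto. }
  destruct (Rle_lt_dec s (p1 P + 2 * (d2 P - m))).
  { destruct (within_T3_cut2 P m s) as (T & ? & ?); auto; try lra.
    exists T; split; auto. }
  destruct (Rlt_le_dec s (s4 - 2 * d2 P)).
  { destruct (within_turn2 P s) as (T & ? & ?); auto; try lra.
    exists T; split; auto. right; right; left. unfold_times; lra. }
  destruct (Rle_lt_dec s s4).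
  { destruct (within_T4_cut2 P s4 s) as (T & ? & ?); auto; try lra.
    exists T; split; auto. }
  destruct (Rle_lt_dec s (p2 P)).
  { destruct (within_T4_arc P s4 s) as (T & ? & ?); auto; try lra.
    exists T; split; auto. }
  destruct (within_T5_arc P t s) as (T & ? & ?); auto; try lra.
  exists T; split; auto.
Qed.

Lemma max_of_five (a b c d e : R) :
  (b <= a /\ c <= a /\ d <= a /\ e <= a) \/
  (a <= b /\ c <= b /\ d <= b /\ e <= b) \/
  (a <= c /\ b <= c /\ d <= c /\ e <= c) \/
  (a <= d /\ b <= d /\ c <= d /\ e <= d) \/
  (a <= e /\ b <= e /\ c <= e /\ d <= e).
Proof.
  destruct (Rle_lt_dec a b), (Rle_lt_dec c d);
    [ destruct (Rle_lt_dec b d); [destruct (Rle_lt_dec d e) | destruct (Rle_lt_dec b e)]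
    | destruct (Rle_lt_dec b c); [destruct (Rle_lt_dec c e) | destruct (Rle_lt_dec b e)]
    | destruct (Rle_lt_dec a d); [destruct (Rle_lt_dec d e) | destruct (Rle_lt_dec a e)]
    | destruct (Rle_lt_dec a c); [destruct (Rle_lt_dec c e) | destruct (Rle_lt_dec a e)] ];
    lra.
Qed.

Theorem theorem2 :
  exists s1 s2 s4 : R,
    unique (is_E1 Alg_star) s1 /\
    unique (is_E2 Alg_star) s2 /\
    unique (is_E4 Alg_star) s4 /\
    (worst_case Alg_star (Exit s1) \/
     worst_case Alg_star (Exit s2) \/
     worst_case Alg_star Artificial3 \/
     worst_case Alg_star (Exit s4) \/
     worst_case Alg_star Artificial5).
Proof.
  pose proof near_star_Alg_star as N. pose proof PI_bounds.
  destruct (E1_root _ N) as (s1 & H1 & R1).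
  destruct (E2_root _ N) as (s2 & H2 & R2).
  destruct (E4_root _ N) as (s4 & H4 & R4).
  destruct (E1_picked_up _ s1 N ltac:(lra) R1) as [U1 V1].
  destruct (E2_picked_up _ s2 N H2 R2) as [U2 V2].
  destruct (E4_picked_up _ s4 N H4 R4) as [U4 V4].
  destruct (artificial3_meeting _ N) as (m & Hm & R3 & V3).
  destruct (artificial5_meeting _ N) as (t & Ht & R5 & V5).
  exists s1, s2, s4.
  split; [|split; [|split]].
  - split; auto. intros s Hs. apply is_E1_equation in Hs; auto.
    apply (chord_sum_inj (p1 Alg_star)). lra.
  - split; auto. intros s Hs. apply is_E2_equation in Hs; auto.
    apply (chord_sum_inj (p1 Alg_star)). lra.
  - split; auto. intros s Hs. apply is_E4_equation in Hs; auto.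
    apply (chord_sum_inj (p2 Alg_star)). lra.
  (* Each exit is bounded by one of the five times, hence by the largest, whichever it is. *)
  - pose proof (fun e => every_exit_bounded _ s1 s2 s4 m t e N H1 R1 H2 R2 H4 R4
      Hm R3 V3 Ht R5 V5) as Bound.
    assert (Worst : forall e T, admissible e -> evacuation_time Alg_star e T ->
      (forall e', admissible e' ->
        exists T', evacuation_time Alg_star e' T' /\ T' <= T) ->
      worst_case Alg_star e) by (intros; split; eauto).
    destruct (max_of_five (1 + 2 * p1 Alg_star - s1)
      (1 + 2 * p1 Alg_star + 4 * d1 Alg_star - s2)
      (cut1_end Alg_star + 2 * (p2 Alg_star - p1 Alg_star + m))
      (1 + 2 * p2 Alg_star + 2 * d1 Alg_star + 4 * d2 Alg_star - s4)
      (cut2_end Alg_star + 2 * t))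
      as [M | [M | [M | [M | M]]]];
      [ left; eapply Worst; [| exact V1 |]
      | right; left; eapply Worst; [| exact V2 |]
      | right; right; left; eapply Worst; [| exact V3 |]
      | right; right; right; left; eapply Worst; [| exact V4 |]
      | right; right; right; right; eapply Worst; [| exact V5 |] ];
      try exact I; try (cbn; unfold on_arc; lra);
      intros e' A'; destruct (Bound e' A') as (T' & ET & LT);
      exists T'; (split; [exact ET | lra]).
Qed.
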